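(* Let $(\Gamma,+)$ be an Artin-Tits group of spherical type, written additively. Then the following two assignments are mutually inverse and constitute a bijective correspondence between the equivalence classes of $\mathrm{I}_\Gamma$-formations and the skew brace structures $(\Gamma,+,\circ)$ on $(\Gamma,+)$ with $\mathrm{im}(\lambda)\leq\mathfrak{D}_\Gamma$: (1) To an $\mathrm{I}_\Gamma$-formation $(H,\iota)$, where the group operation of $H$ is written $\circ$, assign the skew brace $(\Gamma,+,\circ_\iota)$, where $g\circ_\iota h=\iota(\iota^{-1}(g)\circ\iota^{-1}(h))$ for $g,h\in\Gamma$. (2) To a skew brace structure $(\Gamma,+,\circ)$ with $\mathrm{im}(\lambda)\leq\mathfrak{D}_\Gamma$, assign the $\mathrm{I}_\Gamma$-formation $((\Gamma,\circ),\mathrm{id}_\Gamma)$, where $(\Gamma,\circ)$ inherits its order from $(\Gamma,+)$.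
   Context: A Coxeter matrix on a set $S$ is a map $m:S\times S\to\mathbb{Z}_{\geq 1}$, $(i,j)\mapsto m_{ij}$, with $m_{ij}=m_{ji}$ and $m_{ij}=1$ iff $i=j$. For $k\geq 1$, $r_k(x,y)=xyxy\cdots$ denotes the alternating product with $k$ factors starting with $x$. The Artin-Tits monoid $\Gamma^+$ (resp. group $\Gamma$) of $m$ is the monoid (resp. group) with generators $\sigma_i$ ($i\in S$) and relations $r_{m_{ij}}(\sigma_i,\sigma_j)=r_{m_{ij}}(\sigma_j,\sigma_i)$ ($i,j\in S$). It is spherical (of spherical type) if the Coxeter group, obtained from $\Gamma$ by adding the relations $\sigma_i^2=1$, is finite. For spherical $\Gamma$, by Brieskorn–Saito the canonical map $\Gamma^+\to\Gamma$ is injective and its image is the positive cone of a left-invariant lattice order $\leq$ on $\Gamma$: $g\leq h$ iff $g^{-1}h\in\Gamma^+$ (multiplicatively). $\Gamma$ always carries this order. In this statement the group operation of $\Gamma$ is written $+$ (it need not be commutative). For a permutation $\phi$ of $S$ with $m_{\phi(i)\phi(j)}=m_{ij}$ for all $i,j$, let $\delta_\phi$ be the automorphism of $\Gamma$ with $\delta_\phi(\sigma_i)=\sigma_{\phi(i)}$ (a diagram automorphism); $\mathfrak{D}_\Gamma$ is the group of these. A left-ordered group is a group with a partial order such that $y\leq z$ implies $xy\leq xz$. For a left-ordered group $G$, an $\mathrm{I}_G$-formation is a pair $(H,\iota)$ where $H$ is a left-ordered group and $\iota:(H,\leq)\to(G,\leq)$ is an order-isomorphism (not necessarily a group homomorphism)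 with $\iota(e_H)=e_G$. Two $\mathrm{I}_G$-formations $(H,\iota)$, $(H',\iota')$ are equivalent if there is an isomorphism of left-ordered groups $f:H\to H'$ with $\iota'\circ f=\iota$. A skew brace is a set $B$ with two group operations $+$ and $\circ$ (neither necessarily commutative) satisfying $a\circ(b+c)=a\circ b-a+a\circ c$. Its $\lambda$-map is the group homomorphism $\lambda:(B,\circ)\to\mathrm{Aut}(B,+)$, $g\mapsto\lambda_g$, $\lambda_g(h)=-g+g\circ h$. A skew brace structure on $(\Gamma,+)$ is a skew brace $(\Gamma,+,\circ)$ with the given additive group. *)

(* Defs.v *)
From HB Require Import structures.
From mathcomp Require Import all_boot all_order all_algebra.
From mathcomp Require Import boolp classical_sets cardinality.

Set Implicit Arguments.
Unset Strict Implicit.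
Unset Printing Implicit Defensive.

Import Order.TTheory.

Local Open Scope quotient_scope.
Local Open Scope classical_set_scope.
Local Open Scope order_scope.
Local Open Scope group_scope.

Section PresentedMonoid.
Variables (A : choiceType) (R : seq A -> seq A -> Prop).

Inductive word_cong : seq A -> seq A -> Prop :=
| WordRel a u v b : R u v -> word_cong (a ++ u ++ b) (a ++ v ++ b)
| WordRefl u : word_cong u u
| WordSym u v : word_cong u v -> word_cong v u
| WordTrans u v w : word_cong u v -> word_cong v w -> word_cong u w.

Lemma word_cong_ctx a b u v :
  word_cong u v -> word_cong (a ++ u ++ b) (a ++ v ++ b).
Proof.
elim=> [c u' v' d Ruv|w|? ? _|? ? w' _ h1 _ h2].
- have E w : a ++ (c ++ w ++ d) ++ b = (a ++ c) ++ w ++ (d ++ b).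
    by rewrite -!catA.
  by rewrite !E; apply: WordRel.
- exact: WordRefl.
- exact: WordSym.
- exact: WordTrans h1 h2.
Qed.

Lemma word_cong_cat u v u' v' :
  word_cong u v -> word_cong u' v' -> word_cong (u ++ u') (v ++ v').
Proof.
move=> h h'; apply: (@WordTrans _ (v ++ u')).
  exact: (word_cong_ctx [::] u' h).
by have := word_cong_ctx v [::] h'; rewrite !cats0.
Qed.

Definition word_congb (u v : seq A) : bool := `[< word_cong u v >].

Lemma word_congb_equiv : equiv_class_of word_congb.
Proof.
split=> [u|u v|v u w].
- by apply/asboolP; apply: WordRefl.
- by apply/asboolP/asboolP; apply: WordSym.
- by move=> /asboolP huv /asboolP hvw; apply/asboolP; apply: WordTrans huv hvw.
Qed.

Canonical word_cong_equiv := EquivRelPack word_congb_equiv.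

Definition presented_monoid : Type := {eq_quot word_cong_equiv}.

HB.instance Definition _ := Choice.on presented_monoid.

Definition pword (u : seq A) : presented_monoid := \pi_{eq_quot word_cong_equiv} u.
Definition prepr (x : presented_monoid) : seq A :=
  repr (x : {eq_quot word_cong_equiv}).

Lemma pwordP u v : pword u = pword v <-> word_cong u v.
Proof.
by split=> [/eqquotP/asboolP|h]; last apply/eqquotP/asboolP.
Qed.

Lemma preprK x : pword (prepr x) = x.
Proof. exact: reprK. Qed.

Lemma pword_repr u : word_cong (prepr (pword u)) u.
Proof. by apply/pwordP; rewrite preprK. Qed.

Definition pmul (x y : presented_monoid) := pword (prepr x ++ prepr y).

Lemma pmulE u v : pmul (pword u) (pword v) = pword (u ++ v).
Proof. by apply/pwordP/word_cong_cat; apply: pword_repr. Qed.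

Lemma pmulA : associative pmul.
Proof.
move=> x y z; rewrite -(preprK x) -(preprK y) -(preprK z).
by rewrite !pmulE catA.
Qed.

Lemma pmul1l : left_id (pword [::]) pmul.
Proof. by move=> x; rewrite -(preprK x) pmulE. Qed.

Lemma pmul1r : right_id (pword [::]) pmul.
Proof. by move=> x; rewrite -(preprK x) pmulE cats0. Qed.

HB.instance Definition _ := isMonoid.Build presented_monoid pmulA pmul1l pmul1r.

Lemma pwordM u v : pword u * pword v = pword (u ++ v).
Proof. exact: pmulE. Qed.

End PresentedMonoid.

Section PresentedGroup.
Variables (S : choiceType) (R : seq S -> seq S -> Prop).

(* The letter (i, true) is the generator i, and (i, false) its inverse. *)
Definition pos_word (u : seq S) : seq (S * bool) := [seq (i, true) | i <- u].

Definition inv_word (u : seq (S * bool)) : seq (S * bool) :=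
  [seq (x.1, ~~ x.2) | x <- rev u].

Definition group_rel (u v : seq (S * bool)) : Prop :=
  (exists a b, [/\ R a b, u = pos_word a & v = pos_word b])
  \/ (exists x : S * bool, u = [:: x; (x.1, ~~ x.2)] /\ v = [::]).

(* The group presented by positive relations R, as a monoid on the generators
   and their formal inverses. *)
Definition presented_group : Type := presented_monoid group_rel.

HB.instance Definition _ := Monoid.on presented_group.

Definition gword (u : seq (S * bool)) : presented_group := pword group_rel u.
Definition grepr (x : presented_group) : seq (S * bool) := prepr x.

Lemma greprK x : gword (grepr x) = x.
Proof. exact: preprK. Qed.

Lemma gwordM u v : gword u * gword v = gword (u ++ v).
Proof. exact: pwordM. Qed.

Lemma inv_wordK : involutive inv_word.
Proof.
move=> u; rewrite /inv_word -map_rev revK -map_comp.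
by rewrite map_id_in // => -[i b] _ /=; rewrite negbK.
Qed.

Lemma gword_mulV u : gword u * gword (inv_word u) = 1.
Proof.
rewrite gwordM /inv_word; elim: u => [//|x u IHu].
rewrite rev_cons map_rcons /= -cats1.
apply/pwordP; apply: (@WordTrans _ _ _ ([:: x] ++ [::] ++ [:: (x.1, ~~ x.2)])).
  have := word_cong_ctx [:: x] [:: (x.1, ~~ x.2)] (iffLR (pwordP _ _ _) IHu).
  by rewrite /= -catA.
have h : group_rel [:: x; (x.1, ~~ x.2)] [::] by right; exists x.
exact: (WordRel [::] [::] h).
Qed.

Definition ginv (x : presented_group) := gword (inv_word (grepr x)).

Lemma gmulV : right_inverse 1 ginv (@monoid.mul presented_group).
Proof. by move=> x; rewrite -{1}(greprK x) gword_mulV. Qed.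

Lemma gmulVx : left_inverse 1 ginv (@monoid.mul presented_group).
Proof.
move=> x; rewrite -{2}(greprK x) /ginv -{2}(inv_wordK (grepr x)).
exact: gword_mulV.
Qed.

HB.instance Definition _ := hasInv.Build presented_group ginv.
HB.instance Definition _ :=
  Monoid_isGroup.Build presented_group gmulVx gmulV.

Definition ggen (i : S) : presented_group := gword [:: (i, true)].

Definition monoid_to_group (x : presented_monoid R) : presented_group :=
  gword (pos_word (prepr x)).

Lemma monoid_to_groupE u : monoid_to_group (pword R u) = gword (pos_word u).
Proof.
suff H a b : word_cong R a b -> gword (pos_word a) = gword (pos_word b).
  exact/H/pword_repr.
elim=> [c u' v' d Ruv|//|a' b' _ ->//|? ? ? _ -> _ ->//].
rewrite /pos_word !map_cat; apply/pwordP/WordRel.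
by left; exists u', v'.
Qed.

Lemma monoid_to_groupM x y :
  monoid_to_group (x * y) = monoid_to_group x * monoid_to_group y.
Proof.
rewrite -(preprK x) -(preprK y) pwordM !monoid_to_groupE gwordM.
by rewrite /pos_word map_cat.
Qed.

End PresentedGroup.

(* The display only affects the printing of the order, so one fixed display is
   used for all left-ordered groups. *)
Fact lo_display : Order.disp_t. Proof. exact: (Order.Disp tt tt). Qed.

HB.mixin Record isLeftOrdered G of Group G & Order.POrder lo_display G := {
  lo_mul2l : forall x y z : G, y <= z -> x * y <= x * z
}.

#[short(type="leftOrderedGroupType")]
HB.structure Definition LeftOrderedGroup :=
  {G of isLeftOrdered G & Group G & Order.POrder lo_display G}.

Record coxeter_matrix (S : Type) := CoxeterMatrix {
  cox_entry :> S -> S -> nat;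
  cox_pos : forall i j, (0 < cox_entry i j)%N;
  cox_sym : forall i j, cox_entry i j = cox_entry j i;
  cox_eq1 : forall i j, cox_entry i j = 1%N <-> i = j
}.

Fixpoint alternating (T : Type) (k : nat) (x y : T) : seq T :=
  if k is k'.+1 then x :: alternating k' y x else [::].

Lemma size_alternating (T : Type) k (x y : T) : size (alternating k x y) = k.
Proof. by elim: k x y => //= k IHk x y; rewrite IHk. Qed.

Section ArtinTits.
Variables (S : choiceType) (m : coxeter_matrix S).

Definition artin_rel (u v : seq S) : Prop :=
  exists i j, u = alternating (m i j) i j /\ v = alternating (m i j) j i.

Definition coxeter_rel (u v : seq S) : Prop :=
  artin_rel u v \/ (exists i, u = [:: i; i] /\ v = [::]).

Definition artin_monoid : Type := presented_monoid artin_rel.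
HB.instance Definition _ := Monoid.on artin_monoid.

Definition artin_group : Type := presented_group artin_rel.
HB.instance Definition _ := Group.on artin_group.

Definition coxeter_group : Type := presented_group coxeter_rel.
HB.instance Definition _ := Group.on coxeter_group.

Definition spherical : Prop := finite_set [set: coxeter_group].

Definition sigma (i : S) : artin_group := ggen artin_rel i.

Definition artin_canon (x : artin_monoid) : artin_group :=
  @monoid_to_group S artin_rel x.

Definition artin_le (g h : artin_group) : bool :=
  `[< exists x : artin_monoid, g^-1 * h = artin_canon x >].

Let degree (u : seq (S * bool)) : int :=
  (\sum_(x <- u) (if x.2 then 1 else -1))%R.

Let degree_pos u : degree (pos_word u) = ((size u)%:R)%R.
Proof.
rewrite /degree; elim: u => [|i u IHu]; first by rewrite big_nil.
by rewrite /= big_cons IHu -GRing.natr1 GRing.addrC.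
Qed.

Let degree_cong u v :
  word_cong (group_rel artin_rel) u v -> degree u = degree v.
Proof.
have degree_cat a b : degree (a ++ b) = (degree a + degree b)%R.
  by rewrite /degree big_cat.
elim=> [a u' v' b Ruv|//|//|? ? ? _ -> _ ->//].
rewrite !degree_cat; congr (_ + (_ + _))%R.
case: Ruv => [[c [d [[i [j [-> ->]]] -> ->]]]|[[i b'] [-> ->]]].
  by rewrite !degree_pos !size_alternating.
by rewrite /degree !big_cons !big_nil /=; case: b'.
Qed.

Lemma artin_canon_eq1 (x y : artin_monoid) :
  artin_canon x * artin_canon y = 1 -> x = 1.
Proof.
rewrite /artin_canon -monoid_to_groupM -(preprK x) -(preprK y) pwordM.
rewrite monoid_to_groupE => /pwordP/degree_cong.
rewrite degree_pos /degree big_nil size_cat => /eqP; rewrite Num.Theory.pnatr_eq0 addn_eq0.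
by case/andP=> /nilP -> _.
Qed.

Lemma artin_canon1 : artin_canon 1 = 1.
Proof. exact: (monoid_to_groupE _ [::]). Qed.

Lemma artin_le_refl : reflexive artin_le.
Proof. by move=> g; apply/asboolP; exists 1; rewrite mulVg artin_canon1. Qed.

Lemma artin_le_trans : transitive artin_le.
Proof.
move=> h g k /asboolP[x gh] /asboolP[y hk]; apply/asboolP; exists (x * y).
by rewrite /artin_canon monoid_to_groupM -/(artin_canon x) -gh
  -/(artin_canon y) -hk -mulgA mulVKg.
Qed.

Lemma artin_le_anti : antisymmetric artin_le.
Proof.
move=> g h /andP[/asboolP[x gh] /asboolP[y hg]].
have x1 : x = 1 by apply: (@artin_canon_eq1 x y); rewrite -gh -hg -mulgA mulVKg mulVg.
by move: gh; rewrite x1 artin_canon1 => /(congr1 ( *%g g)); rewrite mulVKg mulg1.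
Qed.

HB.instance Definition _ := Order.Le_isPOrder.Build lo_display artin_group
  artin_le_refl artin_le_anti artin_le_trans.

Lemma artin_le_mul2l (x y z : artin_group) : y <= z -> x * y <= x * z.
Proof.
by move=> /asboolP[w yz]; apply/asboolP; exists w; rewrite invgM -mulgA mulKg.
Qed.

HB.instance Definition _ := isLeftOrdered.Build artin_group artin_le_mul2l.

Definition diagram_automorphisms : set (artin_group -> artin_group) :=
  [set f | exists phi : S -> S,
    [/\ bijective phi, forall i j, m (phi i) (phi j) = m i j,
        {morph f : g h / g * h}, bijective f
      & forall i, f (sigma i) = sigma (phi i)]].

Lemma diagram_automorphism_le f :
  diagram_automorphisms f -> {homo f : g h / g <= h}.
Proof.
case=> phi [_ _ fM _ fs] g h /asboolP[x gh]; apply/asboolP.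
have f1 : f 1 = 1.
  by apply: (mulgI (f 1)); rewrite -fM !mulg1.
have fV k : f k^-1 = (f k)^-1.
  by apply: (mulgI (f k)); rewrite -fM !mulgV.
exists (pword artin_rel [seq phi i | i <- prepr x]).
rewrite -fV -fM gh -[in LHS](preprK x) /artin_canon !monoid_to_groupE.
elim: (prepr x) => [//|i u IHu] /=.
have E j w : gword artin_rel (pos_word (j :: w)) = sigma j * gword artin_rel (pos_word w).
  by rewrite /sigma /ggen gwordM.
by rewrite !E fM fs IHu.
Qed.

End ArtinTits.

Arguments sigma {S} m i.
Arguments diagram_automorphisms {S} m.

Section Formations.
Variable G : leftOrderedGroupType.

Record formation := Formation {
  form_group : leftOrderedGroupType;
  form_iso : form_group -> G;
  form_inv : G -> form_group;
  form_isoK : cancel form_iso form_inv;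
  form_invK : cancel form_inv form_iso;
  form_mono : {mono form_iso : x y / x <= y};
  form_iso1 : form_iso 1 = 1
}.

Arguments form_iso : clear implicits.
Arguments form_inv : clear implicits.
Arguments form_isoK : clear implicits.
Arguments form_invK : clear implicits.
Arguments form_mono : clear implicits.

Definition formation_equiv (F F' : formation) : Prop :=
  exists f : form_group F -> form_group F',
    [/\ bijective f, {morph f : x y / x * y}, {mono f : x y / x <= y}
      & forall x, form_iso F' (f x) = form_iso F x].

Definition formation_class : Type :=
  {C : formation -> Prop | exists F, C = formation_equiv F}.

Definition class_of (F : formation) : formation_class :=
  exist _ (formation_equiv F) (ex_intro _ F erefl).

End Formations.

Arguments form_iso {G} F x : rename.
Arguments form_inv {G} F x : rename.
Arguments form_isoK {G} F x : rename.
Arguments form_invK {G} F x : rename.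
Arguments form_mono {G} F x y : rename.

Definition is_group_law (T : Type) (op : T -> T -> T) : Prop :=
  associative op /\
  exists e, [/\ left_id e op, right_id e op
              & exists inv, left_inverse e inv op /\ right_inverse e inv op].

(* The group G, which need not be commutative, is the additive group of the
   skew brace; as MathComp reserves additive notation for commutative groups,
   it is written multiplicatively: a + b, 0 and - a become a * b, 1 and a^-1. *)
Record skew_brace (G : groupType) := SkewBrace {
  circ : G -> G -> G;
  circ_group_law : is_group_law circ;
  circ_distr : forall a b c, circ a (b * c) = circ a b * a^-1 * circ a c
}.

Definition lambda (G : groupType) (B : skew_brace G) (g h : G) : G :=
  g^-1 * circ B g h.

Section DiagramBraces.
Variables (S : choiceType) (m : coxeter_matrix S).

Definition diagram_brace : Type :=
  {B : skew_brace (artin_group m) | range (lambda B) `<=` diagram_automorphisms m}.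

Variable B : diagram_brace.

Definition circ_carrier : Type := artin_group m.
HB.instance Definition _ := Order.POrder.on circ_carrier.

Let op : circ_carrier -> circ_carrier -> circ_carrier := circ (sval B).

Let group_data : {e : circ_carrier & {inv : circ_carrier -> circ_carrier |
  [/\ left_id e op, right_id e op, left_inverse e inv op
    & right_inverse e inv op]}}.
Proof.
have [_ /cid[e [e1 e2 /cid[inv [i1 i2]]]]] := circ_group_law (sval B).
by exists e, inv.
Qed.

Let opA : associative op := proj1 (circ_group_law (sval B)).

Let op1l : left_id (projT1 group_data) op.
Proof. by case: group_data => e [inv []]. Qed.
Let op1r : right_id (projT1 group_data) op.
Proof. by case: group_data => e [inv []]. Qed.
Let opVl : left_inverse (projT1 group_data) (sval (projT2 group_data)) op.
Proof. by case: group_data => e [inv []]. Qed.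
Let opVr : right_inverse (projT1 group_data) (sval (projT2 group_data)) op.
Proof. by case: group_data => e [inv []]. Qed.

HB.instance Definition _ :=
  isGroup.Build circ_carrier opA op1l op1r opVl opVr.

Lemma circ_mul2l (x y z : circ_carrier) : y <= z -> x * y <= x * z.
Proof.
have circE w : x * w = (x : artin_group m) * lambda (sval B) x w :> artin_group m.
  by rewrite /lambda mulVKg.
move=> yz; rewrite [leLHS]circE [leRHS]circE.
apply/artin_le_mul2l/diagram_automorphism_le => //.
by apply: (svalP B); exists x.
Qed.

HB.instance Definition _ := isLeftOrdered.Build circ_carrier circ_mul2l.

Lemma circ_carrier1 : (1 : circ_carrier) = (1 : artin_group m).
Proof.
set a : artin_group m := (1 : circ_carrier).
have a1 : circ (sval B) a 1 = 1 := @mul1g circ_carrier (1 : artin_group m).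
have := circ_distr (sval B) a 1 1; rewrite mulg1 a1 mul1g mulg1.
by move=> /(congr1 (fun x => x * a)); rewrite mul1g mulVg.
Qed.

Definition brace_formation : formation (artin_group m) :=
  @Formation (artin_group m) circ_carrier (fun x => x) (fun x => x)
    (fun=> erefl) (fun=> erefl) (fun _ _ => erefl) circ_carrier1.

End DiagramBraces.

(* Main.v *)
Require Import Defs.
From HB Require Import structures.
From mathcomp Require Import all_boot all_order all_algebra.
From mathcomp Require Import boolp classical_sets cardinality.
From mathcomp Require Import cyclic separable closed_field zify.

Set Implicit Arguments.
Unset Strict Implicit.
Unset Printing Implicit Defensive.

Import Order.TTheory.

Local Open Scope classical_set_scope.
Local Open Scope order_scope.
Local Open Scope group_scope.

(** In a formation [(H, iota)] left translation by [g] in [H], transported to the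
    Artin group [G], is an automorphism of the ordered set [G]; hence so is
    [lambda_g : h |-> g^-1 * (g o h)], and it fixes [1]. Everything reduces to one
    rigidity fact, [order_aut_diagram]: an order automorphism [f] of [G] fixing
    [1] is a diagram automorphism. Then each [lambda_g] is a group automorphism,
    which is the skew brace identity, and the two assignments are visibly inverse
    to each other, [iota] itself being the required equivalence.

    Rigidity. The covers of [g] are the [g * sigma_i], so
    [f (g * sigma_i) = f g * sigma_(phi_g i)] for some permutation [phi_g] of [S].
    The join of [g * sigma_i] and [g * sigma_j] is [g] times the alternating
    product [D_ij] of length [m i j]. Joins are preserved by [f] and so are
    lengths of chains, whence [m (phi_g i) (phi_g j) = m i j]. Between
    [g * sigma_i] and [g * D_ij] the only cover of [g * sigma_i] is
    [g * sigma_i * sigma_j], which forces [phi_(g sigma_i) j = phi_g j] for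
    [j <> i], and then also for [j = i], both maps being bijective. Hence [phi_g]
    does not depend on [g].

    What this uses about [G] is that the Artin monoid [M] is cancellative and
    embeds into [G], and that [D_ij] is the least common right multiple of the
    atoms [i] and [j]. All of it is derived from the finite Coxeter group [W]:

    - [s_i s_j] has order exactly [m i j] in [W], by a reflection representation
      over a field with enough roots of unity ([coxword_alternating_neq1]);
    - counting the reflections crossed by a word modulo 2 gives the exchange
      property ([crossing_exchange]), the theorem of Matsumoto ([matsumoto]), and
      hence a section [lift : W -> M] that is multiplicative on products whose
      lengths add up;
    - finiteness gives a longest element, so the weak order of [W] has joins
      ([weak_join]), and [x] and [w] determine a largest prefix [head_part x w] of
      [w] that can be multiplied by [x] on the left without loss of length;
    - pushing [x] onto a pair [(w, n)] by keeping that prefix in the first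
      component is an action of [M] on [W * M] ([greedy_actM]). The pair reached
      from [(1, 1)] is a factorization of the acting element of [M] whose first
      component is its largest factor coming from [W]; left cancellation
      ([atom_cancel]) and least common multiples ([artin_lcm]) can be read off;
    - the square of the lift of the longest element is central in [M] and is a
      multiple of each atom, so that elements of [G] are fractions with a power of
      it as denominator, and [M] embeds into [G] ([artin_canon_inj]). *)

(** * Words, alternating words and positive words for the Coxeter group *)

Section Words.
Variables (A : choiceType) (R : seq A -> seq A -> Prop).

Lemma word_cong_rel u v : R u v -> word_cong R u v.
Proof. by move=> Ruv; have := WordRel [::] [::] Ruv; rewrite /= !cats0. Qed.

Lemma word_cong_act (X : Type) (act : A -> X -> X) :
    (forall u v, R u v -> forall x, foldr act x u = foldr act x v) ->
  forall u v, word_cong R u v -> forall x, foldr act x u = foldr act x v.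
Proof.
move=> actR u v; elim=> [a u' v' b Ruv|//|? ? _ IH|? ? ? _ IH1 _ IH2] x //.
  by rewrite !foldr_cat (actR _ _ Ruv).
by rewrite IH1.
Qed.

End Words.

Section Alternating.
Variable T : Type.
Implicit Types x y : T.

Lemma alternatingS k x y : alternating k.+1 x y = x :: alternating k y x.
Proof. by []. Qed.

Lemma alternatingSr k x y :
  alternating k.+1 x y = rcons (alternating k x y) (if odd k then y else x).
Proof.
elim: k x y => // k IHk x y.
by rewrite alternatingS IHk alternatingS rcons_cons /=; case: (odd k).
Qed.

Lemma alternatingD k l x y :
  alternating (k + l) x y =
    alternating k x y ++ (if odd k then alternating l y x else alternating l x y).
Proof.
elim: k x y => // k IHk x y.
by rewrite addSn !alternatingS IHk /=; case: (odd k).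
Qed.

Lemma rev_alternating k x y :
  rev (alternating k x y) =
    if odd k then alternating k x y else alternating k y x.
Proof.
elim: k x y => // k IHk x y; rewrite alternatingS rev_cons IHk /=.
case ok: (odd k) => /=; last by rewrite -alternatingS alternatingSr ok.
by rewrite -alternatingS alternatingSr ok.
Qed.

End Alternating.

Section PositiveCoxeterWords.
Variables (S : choiceType) (m : coxeter_matrix S).

Local Notation W := (coxeter_group m).

Definition coxgen (i : S) : W := ggen (coxeter_rel m) i.
Definition coxword (u : seq S) : W := gword (coxeter_rel m) (pos_word u).

Local Notation s := coxgen.
Local Notation wd := coxword.

Lemma coxword_nil : wd [::] = 1. Proof. by []. Qed.

Lemma coxword_seq1 i : wd [:: i] = s i. Proof. by []. Qed.

Lemma coxword_cat u v : wd (u ++ v) = wd u * wd v.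
Proof. by rewrite /wd gwordM /pos_word map_cat. Qed.

Lemma coxword_cons i u : wd (i :: u) = s i * wd u.
Proof. exact: (coxword_cat [:: i]). Qed.

(** Simple reflections are involutions, so formal inverses are superfluous: [W]
    is already presented as a monoid by its positive relations. Invariants of
    [W] therefore only have to be defined on positive words. *)
Lemma coxword_congP u v : wd u = wd v <-> word_cong (coxeter_rel m) u v.
Proof.
split=> [/pwordP|]; last first.
  elim=> [a u' v' b Ruv|//|? ? _ -> //|? ? ? _ -> _ -> //].
  rewrite !coxword_cat; congr (_ * (_ * _)); apply/pwordP.
  by apply: word_cong_rel; left; exists u', v'.
have H a b : word_cong (group_rel (coxeter_rel m)) a b ->
    word_cong (coxeter_rel m) [seq x.1 | x <- a] [seq x.1 | x <- b].
  elim=> [c u' v' d|w|? ? _ /WordSym //|? ? ? _ h1 _ h2].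
  - case=> [[x [y [Rxy -> ->]]]|[[i e] [-> ->]]]; rewrite !map_cat.
      rewrite /pos_word -!map_comp !map_id_in //; exact: WordRel.
    by apply: WordRel; right; exists i.
  - exact: WordRefl.
  - exact: WordTrans h1 h2.
by move/H; rewrite /pos_word -!map_comp !map_id_in.
Qed.

Lemma coxgen_sq i : s i * s i = 1.
Proof.
transitivity (wd [:: i; i]); first by rewrite !coxword_cons coxword_nil mulg1.
rewrite -coxword_nil.
by apply/coxword_congP/word_cong_rel; right; exists i.
Qed.

Lemma coxgenV i : (s i)^-1 = s i.
Proof. by apply/mulg1_eq/coxgen_sq. Qed.

Lemma coxgenK i w : s i * (s i * w) = w.
Proof. by rewrite mulgA coxgen_sq mul1g. Qed.

Lemma coxgenKr i w : w * s i * s i = w.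
Proof. by rewrite -mulgA coxgen_sq mulg1. Qed.

Lemma coxword_rev u : wd (rev u) = (wd u)^-1.
Proof.
elim: u => [|i u IHu]; first by rewrite invg1.
by rewrite rev_cons -cats1 coxword_cat IHu !coxword_cons coxword_nil mulg1
  invgM coxgenV.
Qed.

Lemma coxword_surj w : exists u, wd u = w.
Proof.
rewrite -(greprK w); elim: (grepr w) => [|[i b] u [v vE]]; first by exists [::].
exists (i :: v); rewrite coxword_cons vE.
have -> : (i, b) :: u = [:: (i, b)] ++ u by [].
rewrite -gwordM; congr (_ * _); case: b => //.
rewrite -[LHS]coxgenV /s /ggen.
exact/mulg1_eq/(gword_mulV _ [:: (i, true)]).
Qed.

Lemma coxword_braid i j :
  wd (alternating (m i j) i j) = wd (alternating (m i j) j i).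
Proof.
by apply/coxword_congP/word_cong_rel; left; exists i, j.
Qed.

Lemma coxword_alternatingV k i j :
  (wd (alternating k i j))^-1 =
    wd (if odd k then alternating k i j else alternating k j i).
Proof. by rewrite -coxword_rev rev_alternating. Qed.

Lemma coxword_alternating2 i j : wd (alternating (m i j).*2 i j) = 1.
Proof.
rewrite -addnn alternatingD coxword_cat {1}coxword_braid.
rewrite -[X in X * _]invgK coxword_alternatingV.
by case: (odd _); rewrite mulVg.
Qed.

End PositiveCoxeterWords.

(** * The order of a product of two simple reflections *)

Section ReflectionRepresentation.
Import GRing.Theory.
Local Open Scope ring_scope.
Variables (S : choiceType) (m : coxeter_matrix S).
Variables (K : fieldType) (om : nat -> K).
Hypothesis om_prim : forall n, (0 < n)%N -> (n.*2).-primitive_root (om n).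

Let c n := om n + (om n)^-1.

(** The contragredient of the geometric representation: the simple reflections
    act on functions on [S], which keeps all sums finite for infinite [S].
    [c n] plays the role of [2 * cos (pi / n)]. *)
Definition reflect_along (i : S) (v : S -> K) : S -> K :=
  fun k => v k + c (m i k) * v i.

Local Notation refl := reflect_along.

Let om_neq0 n : (0 < n)%N -> om n != 0.
Proof.
move=> n0; have /prim_expr_order := om_prim n0.
by case: eqP => // ->; rewrite expr0n double_eq0 eqn0Ngt n0 => /esym/eqP; rewrite oner_eq0.
Qed.

Let om_half n : (0 < n)%N -> om n ^+ n = -1.
Proof.
move=> n0; have pr := om_prim n0.
have : (om n ^+ n) ^+ 2 == 1 by rewrite -exprM muln2 (prim_expr_order pr).
rewrite sqrf_eq1 => /orP[|/eqP //]; rewrite -(prim_order_dvd pr).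
by move/(dvdn_leq n0); rewrite -addnn -{3}[n]addn0 leq_add2l leqNgt n0.
Qed.

Let om1 : om 1 = -1. Proof. by rewrite -[LHS]expr1 om_half. Qed.

Let c1 : c 1 = -1 - 1. Proof. by rewrite /c om1 invrN1. Qed.

Let refl_self i v : refl i v i = - v i.
Proof.
have m1 : m i i = 1%N by apply/cox_eq1.
by rewrite /refl m1 c1 mulrBl mulN1r mul1r addrA subrr add0r.
Qed.

Lemma reflect_along_sq i v : refl i (refl i v) = v.
Proof. by apply/funext => k; rewrite {1}/refl refl_self mulrN addrK. Qed.

Section Pair.
Variables (i j : S) (neq_ij : i <> j).

Let n := m i j.
Let w := om n.

Let n0 : (0 < n)%N. Proof. exact: cox_pos. Qed.
Let n1 : (1 < n)%N.
Proof. by rewrite ltn_neqAle n0 andbT eq_sym; apply/eqP => /cox_eq1. Qed.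
Let w0 : w != 0. Proof. exact: om_neq0. Qed.
Let w2 : w ^+ 2 != 1.
Proof.
rewrite -(prim_order_dvd (om_prim n0)); apply/negP => h.
by have := dvdn_leq (isT : (0 < 2)%N) h; move: n1; rewrite -/n; lia.
Qed.

Let A (v : S -> K) := v i + w * v j.
Let B (v : S -> K) := w * v i + v j.

Let refl_ij v : refl i v j = v j + (w + w^-1) * v i. Proof. by []. Qed.
Let refl_ji v : refl j v i = v i + (w + w^-1) * v j.
Proof. by rewrite /refl cox_sym. Qed.

Let swap_first p q : - p + w * (q + (w + w^-1) * p) = w * (w * p + q).
Proof.
rewrite mulrDl !mulrDr [w * (w^-1 * p)]mulrA divff // mul1r.
by rewrite addrCA [- p + _]addrC addrK addrC.
Qed.

Let swap_second p q : w * - p + (q + (w + w^-1) * p) = w^-1 * (p + w * q).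
Proof.
rewrite mulrDr mulrA mulVf // mul1r mulrDl mulrN [q + _]addrCA addKr.
by rewrite addrC.
Qed.

Let A_i v : A (refl i v) = w * B v.
Proof. by rewrite /A refl_self refl_ij swap_first. Qed.

Let B_i v : B (refl i v) = w^-1 * A v.
Proof. by rewrite /B refl_self refl_ij swap_second. Qed.

Let A_j v : A (refl j v) = w^-1 * B v.
Proof. by rewrite /A refl_self refl_ji addrC swap_second addrC. Qed.

Let B_j v : B (refl j v) = w * A v.
Proof. by rewrite /B refl_self refl_ji addrC swap_first addrC. Qed.

Let diff_i v : A v - w * B v = (1 - w ^+ 2) * v i.
Proof. by rewrite /A /B mulrDr opprD addrACA subrr addr0 mulrBl mul1r mulrA expr2. Qed.

Let diff_j v : B v - w * A v = (1 - w ^+ 2) * v j.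
Proof.
by rewrite /A /B mulrDr opprD addrACA subrr add0r mulrBl mul1r mulrA expr2.
Qed.

Let mix x y a b :
  (x - w^-1 * y) * (a - w * b) + (x * (w * b) + y * (w^-1 * a)) = x * a + y * b.
Proof.
rewrite mulrBl !mulrBr mulrACA mulVf // mul1r [w^-1 * y]mulrC -[y * _ * a]mulrA.
by rewrite opprB addrACA !subrK.
Qed.

Let d0 : 1 - w ^+ 2 != 0. Proof. by rewrite subr_eq0 eq_sym. Qed.

Let F k x y v := foldr refl v (alternating k x y).

Let AB_alternating k v :
  [/\ A (F k i j v) = w ^+ k * (if odd k then B v else A v),
      B (F k j i v) = w ^+ k * (if odd k then A v else B v),
      B (F k i j v) = w ^- k * (if odd k then A v else B v)
    & A (F k j i v) = w ^- k * (if odd k then B v else A v)].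
Proof.
elim: k => [|k [h1 h2 h3 h4]]; first by rewrite expr0 invr1 !mul1r.
have FS x y : F k.+1 x y v = refl x (F k y x v) by [].
rewrite !FS A_i B_i A_j B_j h1 h2 h3 h4 -!exprVn !exprS !mulrA /=.
by case: (odd k).
Qed.

(** On the values at [i] and [j], the coordinates [A] and [B] diagonalize both
    rotations and are exchanged, up to powers of [w], by both reflections; after
    [n] steps the powers are [w ^ n = -1] on either side. Every other value
    becomes invariant once a combination of [A] and [B] is added to it, because
    [w ^ 2 <> 1]. *)
Lemma reflect_along_braid v : F n i j v = F n j i v.
Proof.
have [hA _ hB hA'] := AB_alternating n v; have [_ hB' _ _] := AB_alternating n v.
have wn : w ^+ n = -1 by exact: om_half.
rewrite !wn invrN1 in hA hA' hB hB'.
set p := F n i j v in hA hB *; set q := F n j i v in hA' hB' *.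
have eqA : A p = A q by rewrite hA hA'.
have eqB : B p = B q by rewrite hB hB'.
have eq_i : p i = q i by apply: (mulfI d0); rewrite -!diff_i eqA eqB.
have eq_j : p j = q j by apply: (mulfI d0); rewrite -!diff_j eqA eqB.
apply/funext => k.
(* [x] and [y] are chosen such that [v k + x * A v + y * B v] is invariant under
   both reflections. *)
pose e := c (m i k) / (1 - w ^+ 2); pose f := c (m j k) / (1 - w ^+ 2).
pose x := (e + w^-1 * f) / (1 - w^-1 * w^-1).
pose y := (f + w^-1 * e) / (1 - w^-1 * w^-1).
have d1 : 1 - w^-1 * w^-1 != 0.
  by rewrite subr_eq0 eq_sym -invfM invr_eq1 -expr2.
have ex a b : (a + w^-1 * b) / (1 - w^-1 * w^-1)
    - w^-1 * ((b + w^-1 * a) / (1 - w^-1 * w^-1)) = a.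
  rewrite mulrA -mulrBl; apply: (canLR (mulfK d1)).
  by rewrite mulrDr opprD addrA addrK mulrBr mulr1 mulrA [a * _]mulrC.
have eE : x - w^-1 * y = e by exact: ex.
have fE : y - w^-1 * x = f by exact: ex.
pose L (u : S -> K) := u k + (x * A u + y * B u).
have L_i u : L (refl i u) = L u.
  rewrite /L A_i B_i /refl -addrA; congr (_ + _).
  have -> : c (m i k) * u i = e * (A u - w * B u).
    by rewrite diff_i /e mulrA divfK.
  by rewrite -eE mix.
have L_j u : L (refl j u) = L u.
  rewrite /L A_j B_j /refl -addrA; congr (_ + _).
  have -> : c (m j k) * u j = f * (B u - w * A u).
    by rewrite diff_j /f mulrA divfK.
  by rewrite -fE [X in _ + X]addrC mix addrC.
have LF l a b u : (a = i /\ b = j) \/ (a = j /\ b = i) -> L (F l a b u) = L u.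
  elim: l a b => // l IHl a b ab.
  have -> : F l.+1 a b u = refl a (F l b a u) by [].
  by case: (ab) => -[-> ->]; rewrite ?L_i ?L_j IHl //; [right|left].
have : L p = L q by rewrite /p /q !LF //; [right|left].
by rewrite /L eqA eqB => /addIr.
Qed.

(** The rotation multiplies [A] by [w ^ 2], a primitive [n]-th root of unity. *)
Lemma reflect_along_rotation_neq k :
  (0 < k < n)%N -> exists v, F k.*2 i j v <> v.
Proof.
case/andP=> k0 kn; pose v x : K := (x == i)%:R; exists v => Fv.
have [hA _ _ _] := AB_alternating k.*2 v; move: hA.
rewrite Fv odd_double {1 2}/A /v eqxx; have /eqP/negPf -> := nesym neq_ij.
rewrite mulr0 addr0 mulr1 => /esym/eqP; rewrite -(prim_order_dvd (om_prim n0)).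
by move=> h; have := dvdn_leq _ h; rewrite -/n; lia.
Qed.

End Pair.
End ReflectionRepresentation.

Section PrimitiveRoots.
Import GRing.Theory.
Local Open Scope ring_scope.

(** Bezout: [X * (X^n - 1)' - n * (X^n - 1)] is the nonzero constant [n]. *)
Lemma separable_unity_poly (F : fieldType) n :
  n%:R != 0 :> F -> separable_poly ('X^n - 1 : {poly F}).
Proof.
case: n => [/eqP//|n] nz_n; rewrite unlock; apply/Bezout_coprimepP.
exists (- n.+1%:R%:P, 'X); rewrite /= derivB derivC subr0 derivXn.
rewrite mulrnAr -exprS polyC_natr mulNr mulr_natl mulrnBl opprB subrK.
by rewrite -polyC_natr -size_poly_eq1 size_polyC nz_n.
Qed.

Lemma exists_prim_roots :
  exists (K : fieldType) (om : nat -> K), forall n, (0 < n)%N -> n.-primitive_root (om n).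
Proof.
have [K [f _]] := countable_algebraic_closure rat.
exists K.
have h n : exists w : K, (0 < n)%N -> n.-primitive_root w.
  have [->|n0] := posnP n; first by exists 0%R.
  pose p : {poly K} := ('X^n - 1)%R; have [r Dp] := closed_field_poly_normal p.
  rewrite (monicP _) ?monicXnsubC // GRing.scale1r in Dp.
  have rn1 : all n.-unity_root r by apply/allP=> z; rewrite -root_prod_XsubC -Dp.
  have sz_r : (n < (size r).+1)%N by rewrite -(size_prod_XsubC r id) -Dp size_XnsubC.
  have [|z zP zpr] := hasP (has_prim_root n0 rn1 _ sz_r); last by exists z.
  rewrite -separable_prod_XsubC -Dp separable_unity_poly //.
  by rewrite -(rmorph_nat f) fmorph_eq0 Num.Theory.pnatr_eq0 -lt0n.
by have [om omP] := choice h; exists om.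
Qed.

End PrimitiveRoots.

Section Exactness.
Variables (S : choiceType) (m : coxeter_matrix S).

Lemma coxword_alternating_neq1 i j k :
  i <> j -> (0 < k < m i j)%N -> coxword m (alternating k.*2 i j) <> 1.
Proof.
move=> neq_ij kP; have [K [om0 om0P]] := exists_prim_roots.
pose om n := om0 n.*2.
have omP n : (0 < n)%N -> (n.*2).-primitive_root%R (om n).
  by move=> n0; apply: om0P; rewrite double_gt0.
have [v vP] := reflect_along_rotation_neq omP neq_ij kP.
move=> /(@coxword_congP _ _ _ [::])/(@word_cong_act _ _ _ (reflect_along m om)) E.
apply/vP/E => u w [[a [b [-> ->]]]|[a [-> ->]]] x; last exact: reflect_along_sq.
have [-> //|/eqP neq_ab] := eqVneq a b.
exact: reflect_along_braid.
Qed.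

End Exactness.

(** * Length and the exchange property *)

Section Length.
Variables (S : choiceType) (m : coxeter_matrix S).

Local Notation W := (coxeter_group m).
Local Notation s := (coxgen m).
Local Notation wd := (coxword m).

(** The reflections [t] such that the gallery of [u] crosses the wall of [t], in
    order; [t * wd u] is [wd u] with one letter of [u] deleted. *)
Fixpoint crossed (u : seq S) : seq W :=
  if u is i :: u' then s i :: [seq s i * t * s i | t <- crossed u'] else [::].

Lemma crossed_cat u v :
  crossed (u ++ v) = crossed u ++ [seq wd u * t * (wd u)^-1 | t <- crossed v].
Proof.
elim: u => [|i u IHu] /=.
  by rewrite map_id_in // => t _; rewrite coxword_nil invg1 mulg1 mul1g.
rewrite IHu map_cat -map_comp; congr (_ :: (_ ++ _)); apply: eq_map => t /=.
by rewrite coxword_cons invgM coxgenV !mulgA.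
Qed.

(** The letter responsible for [t] is deleted. *)
Lemma mem_crossed u t :
  t \in crossed u -> exists u', size u = (size u').+1 /\ wd u' = t * wd u.
Proof.
elim: u t => // i u IHu t; rewrite inE => /predU1P[->|/mapP[t' /IHu[u' [su wu]] ->]].
  by exists u; rewrite coxword_cons coxgenK.
exists (i :: u'); rewrite /= su; split=> //.
by rewrite !coxword_cons wu -!mulgA coxgenK.
Qed.

Lemma crossed_alternating k i j :
  crossed (alternating k i j) = [seq wd (alternating l.*2.+1 i j) | l <- iota 0 k].
Proof.
elim: k i j => // k IHk i j.
rewrite alternatingS /= IHk -map_comp -[1%N]addn0 iotaDl -map_comp.
congr (_ :: _).
apply: eq_map => l; rewrite [in RHS]/comp add1n doubleS alternatingS coxword_cons.
by rewrite -alternatingS [in RHS]alternatingSr oddS odd_double -cats1 coxword_cat mulgA.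
Qed.

(** Going round a [2 m]-gon the other way. *)
Lemma coxword_alternating_opp k l i j : (k + l = (m i j).*2)%N -> odd k ->
  wd (alternating k i j) = wd (alternating l j i).
Proof.
move=> kl ok; have := coxword_alternating2 m i j.
rewrite -kl alternatingD ok coxword_cat => /mulg1_eq <-.
by rewrite coxword_alternatingV ok.
Qed.

(** Both sides of a braid relation cross the same [m i j] walls, in opposite
    orders. *)
Lemma crossed_braid i j :
  crossed (alternating (m i j) i j) = rev (crossed (alternating (m i j) j i)).
Proof.
rewrite !crossed_alternating -map_rev; apply: (@eq_from_nth _ 1).
  by rewrite !size_map size_rev.
move=> l; rewrite size_map size_iota => lm.
rewrite !(nth_map 0%N) ?size_rev ?size_iota // nth_rev ?size_iota // !nth_iota //; last by lia.
by apply: coxword_alternating_opp; [lia|rewrite /= add0n odd_double].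
Qed.

(** The walls crossed by a word depend on the word, but the parity of the number
    of crossings of each wall depends only on its value in [W]. *)
Definition parity_of (u : seq S) (t : W) : bool := odd (count_mem t (crossed u)).

Lemma conj_eq (w x t : W) : (w * x * w^-1 == t) = (x == w^-1 * t * w).
Proof.
apply/eqP/eqP => [<-|->]; first by rewrite !mulgA mulVg mul1g mulgVK.
by rewrite !mulgA mulgV mul1g mulgK.
Qed.

Lemma parity_of_cat u v t :
  parity_of (u ++ v) t = parity_of u t (+) parity_of v ((wd u)^-1 * t * wd u).
Proof.
rewrite /parity_of crossed_cat count_cat oddD count_map; congr (_ (+) odd _).
by apply: eq_count => x /=; rewrite conj_eq.
Qed.

Lemma parity_of_congr u v : wd u = wd v -> parity_of u =1 parity_of v.
Proof.
move/coxword_congP; elim=> {u v} [a u v b Ruv|//|u v _ h|u v w _ h1 _ h2] t.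
- have uv : wd u = wd v by apply/coxword_congP/word_cong_rel.
  rewrite !parity_of_cat uv; congr (_ (+) (_ (+) _)).
  move: (_ * _ * wd a) => x {uv}.
  case: Ruv => [[i [j [-> ->]]]|[i [-> ->]]].
    by rewrite /parity_of crossed_braid count_rev.
  by rewrite /parity_of /= coxgenKr; case: (_ == _).
- by rewrite h.
- by rewrite h1 h2.
Qed.

Lemma reduced_word_ex w :
  exists u, wd u = w /\ forall v, wd v = w -> (size u <= size v)%N.
Proof.
pose P n := `[< exists u, wd u = w /\ size u = n >].
have exP : exists n, P n.
  by have [u uw] := coxword_surj w; exists (size u); apply/asboolP; exists u.
case: (ex_minnP exP) => n /asboolP[u [uw un]] nmin.
exists u; split=> // v vw; rewrite un; apply: nmin; apply/asboolP.
by exists v.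
Qed.

Definition reduced_word w : seq S := projT1 (cid (reduced_word_ex w)).
Definition coxlen w : nat := size (reduced_word w).
Arguments coxlen w%_g.

Local Notation red := reduced_word.
Local Notation len := coxlen.

Lemma reduced_wordK w : wd (red w) = w.
Proof. by rewrite /red; case: cid => u []. Qed.

Lemma coxlen_le u : (len (wd u) <= size u)%N.
Proof. by rewrite /len /red; case: cid => v [_] /=; apply. Qed.

Lemma coxlen_eq0 w : len w = 0%N -> w = 1.
Proof. by move/size0nil => w0; rewrite -(reduced_wordK w) w0. Qed.

Lemma coxlen1 : len 1 = 0%N.
Proof. by apply/eqP; rewrite -leqn0 -(coxword_nil m) coxlen_le. Qed.

Lemma coxlenM x y : (len (x * y) <= len x + len y)%N.
Proof.
by rewrite -{1}(reduced_wordK x) -{1}(reduced_wordK y) -coxword_cat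
  (leq_trans (coxlen_le _)) // size_cat.
Qed.

Lemma coxlenV x : len x^-1 = len x.
Proof.
have H y : (len y^-1 <= len y)%N.
  by rewrite -{1}(reduced_wordK y) -coxword_rev (leq_trans (coxlen_le _)) // size_rev.
by apply/eqP; rewrite eqn_leq H -{1}(invgK x) H.
Qed.

(** Whether the wall of [t] separates [1] from [w]. *)
Definition crossing (w t : W) : bool := parity_of (red w) t.

Lemma crossing_word u t : crossing (wd u) t = parity_of u t.
Proof. by apply: parity_of_congr; rewrite reduced_wordK. Qed.

Lemma crossingM x y t : crossing (x * y) t = crossing x t (+) crossing y (x^-1 * t * x).
Proof.
rewrite -(reduced_wordK x) -(reduced_wordK y) -coxword_cat !crossing_word.
exact: parity_of_cat.
Qed.

Lemma crossing1 t : crossing 1 t = false.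
Proof. by rewrite -(coxword_nil m) crossing_word. Qed.

Lemma crossing_gen i : crossing (s i) (s i).
Proof.
by rewrite -{1}coxword_seq1 crossing_word /parity_of /= eqxx.
Qed.

Lemma crossing_exchange w t : crossing w t ->
  exists u, len w = (size u).+1 /\ wd u = t * w.
Proof.
move=> h; have /mem_crossed[u [su wu]] : t \in crossed (red w).
  by rewrite -has_pred1 has_count; move: h; rewrite /crossing /parity_of; case: count.
by exists u; rewrite -su wu reduced_wordK.
Qed.

(** Along a palindromic word for [t] the crossings other than the middle one
    pair off. *)
Lemma crossing_refl x i : crossing (x * s i * x^-1) (x * s i * x^-1).
Proof.
set t := x * _ * _; have tE : x^-1 * t * x = s i.
  by rewrite /t !mulgA mulVg mul1g mulgVK.
rewrite {1}/t -mulgA crossingM tE crossingM coxgenV crossing_gen.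
rewrite coxgen_sq mul1g.
have : crossing (x * x^-1) t = false by rewrite mulgV crossing1.
by rewrite crossingM tE; do 2!case: crossing.
Qed.

(** If [t] is not crossed by [w], it is crossed by [t * w], to which the exchange
    property applies. *)
Lemma crossing_len x i w (t := x * s i * x^-1) :
  crossing w t = (len (t * w) < len w)%N.
Proof.
have t2 : t * t = 1.
  by rewrite /t !mulgA mulgVK -[x * s i * s i]mulgA coxgen_sq mulg1 mulgV.
have H v : crossing v t -> (len (t * v) < len v)%N.
  by case/crossing_exchange => u [-> <-]; rewrite ltnS coxlen_le.
apply/idP/idP; first exact: H.
apply: contraTT => nw; rewrite -leqNgt ltnW // -{1}[w]mul1g -t2 -mulgA; apply: H.
have tV : t^-1 = t by exact/mulg1_eq.
by rewrite crossingM crossing_refl tV t2 mul1g (negPf nw).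
Qed.

Lemma crossing_genlen i w : crossing w (s i) = (len (s i * w) < len w)%N.
Proof. by have := crossing_len 1 i w; rewrite mul1g invg1 mulg1. Qed.

Lemma coxlen_gen_down i w : crossing w (s i) -> len w = (len (s i * w)).+1.
Proof.
move=> h; have := h; rewrite crossing_genlen.
have [u [lw uw]] := crossing_exchange h.
have := coxlen_le u; rewrite uw => lu; move=> lt.
have := coxlenM (s i) (s i * w); rewrite coxgenK.
have : (len (s i) <= 1)%N.
  by rewrite -coxword_seq1 coxlen_le.
lia.
Qed.

Lemma coxlen_gen_up i w : ~~ crossing w (s i) -> len (s i * w) = (len w).+1.
Proof.
move=> h; rewrite (@coxlen_gen_down i) ?coxgenK //.
have := crossing_gen i; rewrite crossingM => ->.
by rewrite coxgenV coxgen_sq mul1g (negPf h).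
Qed.

Lemma coxlen_gen i : len (s i) = 1%N.
Proof. by rewrite -{1}[s i]mulg1 coxlen_gen_up ?coxlen1 // crossing1. Qed.

(** A wall crossed twice would make an alternating word of length less than
    [2 * m i j] trivial. *)
Lemma coxlen_alternating k i j :
  i <> j -> (k <= m i j)%N -> len (wd (alternating k i j)) = k.
Proof.
elim: k i j => [|k IHk] i j neq_ij; first by rewrite coxlen1.
move=> km; rewrite alternatingS coxword_cons coxlen_gen_up ?IHk //.
- exact/nesym.
- by rewrite cox_sym ltnW.
rewrite crossing_word /parity_of crossed_alternating.
suff /count_memPn -> : s i \notin [seq wd (alternating l.*2.+1 j i) | l <- iota 0 k] by [].
apply/negP => /mapP[l]; rewrite mem_iota /= => lk E.
apply: (@coxword_alternating_neq1 _ m i j l.+1) => //; first by lia.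
by rewrite doubleS alternatingS coxword_cons -E coxgen_sq.
Qed.

End Length.

Arguments coxlen {S m} w%_g.

(** The same product of [W] can be elaborated through several structures, so
    lengths are generalized up to conversion before linear arithmetic. *)
Ltac len_lia :=
  repeat match goal with H : context [coxlen _] |- _ => move: H end;
  repeat match goal with |- context [@coxlen ?S ?m ?x] =>
    move: (@coxlen S m x) => ? end;
  lia.

(** * The weak order and its joins *)

Section WeakOrder.
Variables (S : choiceType) (m : coxeter_matrix S).

Local Notation W := (coxeter_group m).
Local Notation s := (coxgen m).
Local Notation wd := (coxword m).
Local Notation len := coxlen.
Implicit Types u v w x y z : W.

Definition len_additive x y : Prop := len (x * y) = (len x + len y)%N.

(** The right weak order: [x] is a prefix of a reduced word of [w]. *)
Definition weak_le x w : Prop := len_additive x (x^-1 * w).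

Lemma weak_leE x w : weak_le x w <-> len w = (len x + len (x^-1 * w))%N.
Proof. by rewrite /weak_le /len_additive mulVKg. Qed.

Lemma weak_le_mulr x y : weak_le x (x * y) <-> len_additive x y.
Proof. by rewrite /weak_le mulKg. Qed.

Lemma weak_le1 w : weak_le 1 w.
Proof. by rewrite weak_leE coxlen1 invg1 mul1g. Qed.

Lemma weak_le_refl w : weak_le w w.
Proof. by rewrite weak_leE mulVg coxlen1 addn0. Qed.

Lemma weak_le_mul z x w :
  weak_le z w -> (weak_le x (z^-1 * w) <-> len_additive z x /\ weak_le (z * x) w).
Proof.
rewrite !weak_leE /len_additive invgM -mulgA => zw.
have h1 := coxlenM z x; have h2 := coxlenM (z * x) (x^-1 * (z^-1 * w)).
rewrite -mulgA !mulVKg in h2.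
by split=> [|[]]; len_lia.
Qed.

Lemma weak_le_trans x y z : weak_le x y -> weak_le y z -> weak_le x z.
Proof.
rewrite !weak_leE => xy yz.
have h1 := coxlenM (x^-1 * y) (y^-1 * z).
rewrite -mulgA mulVKg in h1.
have h2 := coxlenM x (x^-1 * z); rewrite mulVKg in h2.
by len_lia.
Qed.

Lemma weak_le_len x y : weak_le x y -> (len x <= len y)%N.
Proof. by rewrite weak_leE => ->; rewrite leq_addr. Qed.

Lemma weak_le_eq x y : weak_le x y -> (len y <= len x)%N -> x = y.
Proof.
rewrite weak_leE => xy yx.
have /coxlen_eq0 /mulg1_eq : len (x^-1 * y) = 0%N by len_lia.
by rewrite invgK.
Qed.

Lemma weak_le_anti x y : weak_le x y -> weak_le y x -> x = y.
Proof. by move=> xy /weak_le_len; apply: weak_le_eq. Qed.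

Lemma weak_le_gen i w : weak_le (s i) w <-> crossing w (s i).
Proof.
rewrite weak_leE coxlen_gen coxgenV; split=> [E|/coxlen_gen_down ->//].
by rewrite crossing_genlen E.
Qed.

Lemma weak_le_cover z u :
  weak_le z u -> z <> u -> exists i, len_additive z (s i) /\ weak_le (z * s i) u.
Proof.
move=> zu neq; suff [i h] : exists i, weak_le (s i) (z^-1 * u).
  by exists i; apply/weak_le_mul.
case E: (reduced_word (z^-1 * u)) => [|i r].
  by case: neq; move: (coxlen_eq0 (congr1 size E)) => /mulg1_eq; rewrite invgK.
exists i; rewrite weak_leE coxlen_gen coxgenV.
have wE := reduced_wordK (z^-1 * u); rewrite E coxword_cons in wE.
have rE : s i * (z^-1 * u) = wd r by rewrite -wE coxgenK.
have lE : len (z^-1 * u) = (size r).+1 by rewrite /coxlen E.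
have := coxlen_le m r; have := coxlenM (s i) (wd r).
by rewrite coxlen_gen wE rE lE; len_lia.
Qed.

Lemma weak_le_alternating i j :
  i <> j -> weak_le (s i) (wd (alternating (m i j) i j)).
Proof.
move=> neq_ij; apply/weak_le_gen; rewrite crossing_genlen.
have := cox_pos m i j; case E: (m i j) => [//|k] _.
rewrite alternatingS coxword_cons coxgenK -coxword_cons -alternatingS.
by rewrite !coxlen_alternating ?E // 1?cox_sym ?E //; apply/nesym.
Qed.

(** A prefix of [w] alternating in [i] and [j] can be extended, at its front,
    until its length reaches [m i j]: the other letter is also a prefix of [w],
    and the exchange property deletes a letter, which cannot lie in the
    alternating prefix as long as this is shorter than [m i j]. *)
Lemma weak_le_rank2 i j w : i <> j ->
  weak_le (s i) w -> weak_le (s j) w -> weak_le (wd (alternating (m i j) i j)) w.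
Proof.
move=> neq_ij /weak_le_gen iw /weak_le_gen jw.
have H k : (k <= m i j)%N -> exists a b, ((a = i /\ b = j) \/ (a = j /\ b = i)) /\
    weak_le (wd (alternating k a b)) w.
  elim: k => [_|k IHk km]; first by exists i, j; split; [left|exact: weak_le1].
  have [|a [b [ab]]] := IHk; first exact: ltnW.
  have neq_ab : b <> a by case: ab => -[-> ->] //; apply/nesym.
  have mab : m b a = m i j by case: ab => -[-> ->] //; rewrite cox_sym.
  have bw : crossing w (s b) by case: ab => -[_ ->].
  set x := wd _; rewrite weak_leE; set y := x^-1 * w => lw.
  have lx : len x = k.
    by apply: coxlen_alternating; [exact/nesym|rewrite cox_sym mab ltnW].
  have bxE : wd (alternating k.+1 b a) = s b * x by rewrite alternatingS coxword_cons.
  have lbx : len (s b * x) = k.+1 by rewrite -bxE coxlen_alternating // mab.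
  (* The wall of [s b] is crossed after the alternating prefix. *)
  have : crossing y (x^-1 * s b * x).
    have wE : w = x * y by rewrite mulVKg.
    have : crossing x (s b) = false by rewrite crossing_genlen lbx lx ltnNge leqnSn.
    by move: bw; rewrite {1}wE crossingM => bw xb; rewrite xb in bw.
  case/crossing_exchange => u [ly uE].
  exists b, a; split; first by case: ab => -[-> ->]; [right|left].
  have yE : (s b * x)^-1 * w = wd u.
    by rewrite uE /y invgM coxgenV !mulgA mulgK.
  rewrite weak_leE bxE yE lbx.
  have := coxlen_le m u; have := coxlenM (s b * x) (wd u).
  by rewrite -yE mulVKg lbx; len_lia.
have [//|a [b [ab]]] := H (m i j).
by case: ab => -[-> ->] //; rewrite coxword_braid.
Qed.

End WeakOrder.

Section Longest.
Variables (S : choiceType) (m : coxeter_matrix S) (hm : spherical m).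

Local Notation W := (coxeter_group m).
Local Notation s := (coxgen m).
Local Notation wd := (coxword m).
Local Notation len := coxlen.
Implicit Types u v w x y z : W.

(** The only place where finiteness of the Coxeter group enters. *)
Lemma longest_ex : exists w0 : W, forall w, (len w <= len w0)%N.
Proof.
have [r rE] := (finite_seqP _).1 hm.
have rT w : w \in r by have : [set: W] w by []; rewrite rE.
pose P n := `[< exists w : W, len w = n >].
have exP : exists n, P n by exists (len (1 : W)); apply/asboolP; exists 1.
have PN n : P n -> (n <= \max_(w <- r) len w)%N.
  by move/asboolP => [w <-]; apply: leq_bigmax_seq.
case: (ex_maxnP exP PN) => n /asboolP[w0 <-] n_max.
by exists w0 => w; apply: n_max; apply/asboolP; exists w.
Qed.

Definition longest : W := projT1 (cid longest_ex).
Local Notation w0 := longest.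

Lemma longest_max w : (len w <= len w0)%N.
Proof. by rewrite /longest; case: cid => /=. Qed.

(** Otherwise multiplication by the reflection would increase the length. *)
Lemma longest_crossing x i : crossing w0 (x * s i * x^-1).
Proof.
have [//|h] := boolP (crossing w0 (x * s i * x^-1)).
have := longest_max (x * s i * x^-1 * w0); rewrite leq_eqVlt => /orP[/eqP E|].
  set t := (x * s i * x^-1) in E h.
  have tV : t^-1 = t by apply/mulg1_eq; rewrite /t !mulgA mulgVK coxgenKr mulgV.
  have t2 : t * t = 1 by rewrite -{1}tV mulVg.
  have : crossing (t * w0) t.
    by rewrite crossingM crossing_refl tV t2 mul1g (negPf h).
  by rewrite crossing_len mulgA t2 mul1g E ltnn.
by rewrite -crossing_len (negPf h).
Qed.

Lemma weak_le_longest x : weak_le x w0.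
Proof.
suff H r : len (wd r) = size r -> weak_le (wd r) w0.
  by rewrite -(reduced_wordK x); apply: H; rewrite reduced_wordK.
elim/last_ind: r => [_|r i IHr]; first by rewrite coxword_nil; apply: weak_le1.
rewrite -cats1 coxword_cat coxword_seq1 size_cat addn1 => lri.
have lr : len (wd r) = size r.
  have := coxlen_le m r; have := coxlenM (wd r) (s i).
  by rewrite coxlen_gen lri; len_lia.
apply: (proj2 ((weak_le_mul (s i) (IHr lr)).1 _)).
apply/weak_le_gen; rewrite crossingM invgK longest_crossing addbT.
by rewrite crossing_genlen -{1}coxgenV -invgM !coxlenV lri lr ltnNge leqnSn.
Qed.

(** The elements that can be appended to [x] without loss of length form a
    principal ideal of the weak order; in particular they are closed under
    joins. *)
Lemma len_additiveE x y : len_additive x y <-> weak_le y (x^-1 * w0).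
Proof.
split=> [xy|/(weak_le_mul _ (weak_le_longest x))[] //].
by apply/(weak_le_mul _ (weak_le_longest x)); split=> //; apply: weak_le_longest.
Qed.

(** Descending induction on [z]: if [u] and [v] start with different letters [i]
    and [j] after [z], the dihedral element [z * d] lies below every common upper
    bound, and joins above [z * s i] and [z * s j] are known. *)
Lemma weak_join_above n z u v : (len w0 - len z <= n)%N ->
    weak_le z u -> weak_le z v ->
  exists j, [/\ weak_le u j, weak_le v j &
    forall w, weak_le u w -> weak_le v w -> weak_le j w].
Proof.
elim: n z u v => [|n IHn] z u v zn zu zv.
  have zw0 : z = w0 by apply: weak_le_eq (weak_le_longest z) _; len_lia.
  have top y : weak_le z y -> y = z.
    by move=> zy; apply/esym/(weak_le_eq zy); rewrite zw0 longest_max.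
  by exists z; rewrite (top _ zu) (top _ zv); split=> //; apply: weak_le_refl.
have [<-|zNu] := EM (z = u); first by exists v; split=> // ; exact: weak_le_refl.
have [<-|zNv] := EM (z = v); first by exists u; split=> // ; exact: weak_le_refl.
have [i [zi iu]] := weak_le_cover zu zNu; have [j [zj jv]] := weak_le_cover zv zNv.
have ltw y k : len_additive z (s k) -> weak_le (z * s k) y -> 
    (len w0 - len (z * s k) <= n)%N.
  rewrite /len_additive coxlen_gen => E _; rewrite E; move: zn; len_lia.
have [ij|neq_ij] := EM (i = j).
  by rewrite -ij in jv; apply: IHn (ltw _ _ zi iu) iu jv.
pose d := wd (alternating (m i j) i j).
have d_le w : weak_le (z * s i) w -> weak_le (z * s j) w -> weak_le z w ->
    len_additive z d /\ weak_le (z * d) w.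
  move=> iw jw zw; apply/(weak_le_mul _ zw); apply: weak_le_rank2 => //.
    by apply/(weak_le_mul _ zw).
  by apply/(weak_le_mul _ zw).
have [zd _] := d_le _ (weak_le_longest _) (weak_le_longest _) (weak_le_longest _).
have zzd : weak_le z (z * d) by apply/weak_le_mulr.
have id : weak_le (z * s i) (z * d).
  apply: (proj2 ((weak_le_mul (s i) zzd).1 _)); rewrite mulKg.
  exact: weak_le_alternating.
have jd : weak_le (z * s j) (z * d).
  apply: (proj2 ((weak_le_mul (s j) zzd).1 _)); rewrite mulKg /d coxword_braid cox_sym.
  by apply: weak_le_alternating; apply/nesym.
have [a [ua da a_min]] := IHn _ _ _ (ltw _ _ zi iu) iu id.
have [b [vb db b_min]] := IHn _ _ _ (ltw _ _ zj jv) jv jd.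
have ida := weak_le_trans id da; have idb := weak_le_trans id db.
have [c [ac bc c_min]] := IHn _ _ _ (ltw _ _ zi iu) ida idb.
exists c; split; [exact: weak_le_trans ua ac|exact: weak_le_trans vb bc|].
move=> w uw vw.
have [_ dw] := d_le w (weak_le_trans iu uw) (weak_le_trans jv vw) (weak_le_trans zu uw).
by apply: c_min; [apply: a_min|apply: b_min].
Qed.

Lemma weak_join u v : exists j, [/\ weak_le u j, weak_le v j &
  forall w, weak_le u w -> weak_le v w -> weak_le j w].
Proof. exact: (weak_join_above (leqnn _) (weak_le1 u) (weak_le1 v)). Qed.

(** An element of maximal length with both properties absorbs every other one,
    since their join has both properties again. *)
Lemma head_ex x w : exists v, [/\ weak_le v w, len_additive x v &
  forall v', weak_le v' w -> len_additive x v' -> weak_le v' v].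
Proof.
pose P n := `[< exists v, [/\ weak_le v w, len_additive x v & len v = n] >].
have exP : exists n, P n.
  exists 0%N; apply/asboolP; exists 1; split; [exact: weak_le1| |exact: coxlen1].
  by rewrite /len_additive mulg1 coxlen1 addn0.
have PN n : P n -> (n <= len w)%N by move/asboolP => [v [/weak_le_len vw _ <-]].
case: (ex_maxnP exP PN) => n /asboolP[v [vw xv <-]] v_max.
exists v; split=> // v' vw' xv'.
have [j [vj vj' j_min]] := weak_join v v'.
suff -> : v = j by [].
apply: weak_le_eq vj _; apply: v_max; apply/asboolP; exists j; split=> //.
  exact: j_min.
by apply: (len_additiveE x j).2; apply: j_min; apply: (len_additiveE x _).1.
Qed.

Definition head_part x w : W := projT1 (cid (head_ex x w)).

Lemma head_partP x w : [/\ weak_le (head_part x w) w, len_additive x (head_part x w) &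
  forall v, weak_le v w -> len_additive x v -> weak_le v (head_part x w)].
Proof. by rewrite /head_part; case: cid. Qed.

End Longest.

(** * Normal forms, cancellation and least common multiples in the Artin monoid *)

Section MonoidWords.
Variables (S : choiceType) (m : coxeter_matrix S).

Local Notation M := (artin_monoid m).

Definition atom (i : S) : M := pword (artin_rel m) [:: i].
Definition artin_word (u : seq S) : M := pword (artin_rel m) u.

Lemma artin_word_nil : artin_word [::] = 1. Proof. by []. Qed.

Lemma artin_word_cat u v : artin_word (u ++ v) = artin_word u * artin_word v.
Proof. by rewrite /artin_word -pwordM. Qed.

Lemma artin_word_cons i u : artin_word (i :: u) = atom i * artin_word u.
Proof. exact: (artin_word_cat [:: i]). Qed.

Lemma artin_word_surj (x : M) : exists u, artin_word u = x.
Proof. by exists (prepr x); apply: preprK. Qed.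

Lemma artin_wordP u v : artin_word u = artin_word v <-> word_cong (artin_rel m) u v.
Proof. exact: pwordP. Qed.

Lemma artin_word_braid i j :
  artin_word (alternating (m i j) i j) = artin_word (alternating (m i j) j i).
Proof. by apply/artin_wordP/word_cong_rel; exists i, j. Qed.

Lemma artin_word_size u v : artin_word u = artin_word v -> size u = size v.
Proof.
move/artin_wordP; elim=> [a x y b [i [j [-> ->]]]|//|? ? _ ->//|? ? ? _ -> _ ->//].
by rewrite !size_cat !size_alternating.
Qed.

End MonoidWords.

Section Lift.
Variables (S : choiceType) (m : coxeter_matrix S).

Local Notation W := (coxeter_group m).
Local Notation s := (coxgen m).
Local Notation wd := (coxword m).
Local Notation len := coxlen.
Local Notation M := (artin_monoid m).
Local Notation aw := (artin_word m).

(** Two reduced words of the same element starting with [i] and [j] are both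
    braid equivalent to reduced words starting with the two sides of the braid
    relation, followed by a common tail. *)
Lemma matsumoto n u v : size u = n -> len (wd u) = n -> size v = n -> wd u = wd v ->
  aw u = aw v.
Proof.
elim: n u v => [|n IHn] [|i u] [|j v] // [su] lu [sv] uv.
have len_tl k r : size r = n -> len (wd (k :: r)) = n.+1 -> len (wd r) = n.
  move=> sr; rewrite coxword_cons => lr; apply/eqP; rewrite eqn_leq.
  have := coxlen_le m r; rewrite sr => -> /=.
  by have := coxlenM (s k) (wd r); rewrite coxlen_gen lr; len_lia.
have lu' := len_tl _ _ su lu.
have lv : len (wd (j :: v)) = n.+1 by rewrite -uv.
have lv' := len_tl _ _ sv lv.
have [ij|neq_ij] := EM (i = j).
  rewrite !artin_word_cons -ij (IHn u v) //.
  by move: uv; rewrite !coxword_cons -ij => /mulgI.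
have le_hd k r : size r = n -> len (wd (k :: r)) = n.+1 -> weak_le (s k) (wd (k :: r)).
  move=> sr lr; apply/weak_le_gen; rewrite crossing_genlen {1}coxword_cons coxgenK.
  by rewrite lr (len_tl k).
have iu := le_hd i u su lu; have jv := le_hd j v sv lv; rewrite -uv in jv.
have := weak_le_rank2 neq_ij iu jv; rewrite weak_leE coxlen_alternating // lu.
set y := _^-1 * _ => ly; set t := reduced_word y.
have st : size t = len y by [].
have yE : wd t = y by exact: reduced_wordK.
have uE : wd (i :: u) = wd (alternating (m i j) i j ++ t).
  by rewrite coxword_cat yE /y mulVKg.
have main a b r : a <> b -> m a b = m i j -> size r = n -> len (wd r) = n ->
    wd (a :: r) = wd (alternating (m a b) a b ++ t) ->
    aw (a :: r) = aw (alternating (m a b) a b ++ t).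
  move=> _ mab sr lr; have := cox_pos m a b; rewrite mab.
  case E: (m i j) => [//|k] _; rewrite alternatingS cat_cons !coxword_cons => /mulgI rE.
  rewrite !artin_word_cons (IHn r (alternating k b a ++ t)) //.
  by rewrite size_cat size_alternating st; move: ly; rewrite E; len_lia.
rewrite (main i j u) // (main j i v) //; first last.
- by rewrite -uv uE !coxword_cat cox_sym coxword_braid.
- by rewrite cox_sym.
- exact/nesym.
by rewrite !artin_word_cat artin_word_braid cox_sym.
Qed.

(** By [matsumoto] the chosen reduced word does not matter. *)
Definition lift (w : W) : M := aw (reduced_word w).
Arguments lift w%_g.

Lemma lift_word u : len (wd u) = size u -> lift (wd u) = aw u.
Proof.
by move=> lu; apply: (@matsumoto (size u)); rewrite ?reduced_wordK // -lu.
Qed.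

Lemma lift1 : lift 1 = 1.
Proof. by rewrite -(coxword_nil m) lift_word // coxword_nil coxlen1. Qed.

Lemma lift_gen i : lift (s i) = atom m i.
Proof. by rewrite -coxword_seq1 lift_word // coxword_seq1 coxlen_gen. Qed.

Lemma lift_mul x y : len_additive x y -> lift (x * y) = lift x * lift y.
Proof.
move=> xy; rewrite {2 3}/lift -artin_word_cat -lift_word.
  by rewrite coxword_cat !reduced_wordK.
by rewrite coxword_cat !reduced_wordK xy size_cat.
Qed.

Lemma lift_weak_le x w : weak_le x w -> lift w = lift x * lift (x^-1 * w).
Proof. by move=> xw; rewrite -lift_mul // mulVKg. Qed.

Lemma lift_alternating i j k : i <> j -> (k <= m i j)%N ->
  lift (wd (alternating k i j)) = aw (alternating k i j).
Proof.
by move=> neq_ij km; rewrite lift_word // size_alternating coxlen_alternating.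
Qed.

End Lift.

Arguments lift {S m} w%_g.

Section NormalForm.
Variables (S : choiceType) (m : coxeter_matrix S) (hm : spherical m).

Local Notation W := (coxeter_group m).
Local Notation s := (coxgen m).
Local Notation wd := (coxword m).
Local Notation len := coxlen.
Local Notation M := (artin_monoid m).
Local Notation aw := (artin_word m).
Local Notation hd := (head_part hm).

(** Left multiplication of [lift w * n] by [lift x], renormalized: as much of [w]
    as possible is joined to [x], and the rest is handed over to [n]. *)
Definition greedy_act (x : W) (p : W * M) : W * M :=
  (x * hd x p.1, lift ((hd x p.1)^-1 * p.1) * p.2).

Lemma weak_le_mul2l (x u v : W) : len_additive x v -> weak_le u v -> weak_le (x * u) (x * v).
Proof.
move=> xv uv; have := weak_le_mul u ((weak_le_mulr x v).2 xv).
by rewrite mulKg => /iffLR/(_ uv)[].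
Qed.

Lemma len_additiveA (x y z : W) : len_additive x y ->
  (len_additive (x * y) z <-> len_additive y z /\ len_additive x (y * z)).
Proof.
rewrite /len_additive => xy; rewrite -mulgA xy.
have := coxlenM y z; have := coxlenM x (y * z).
by split=> [|[]]; len_lia.
Qed.

(** Pushing [y] and then [x] keeps exactly what pushing [x * y] keeps; this is
    where maximality of the head is used in both directions. *)
Lemma head_partM (x y w : W) : len_additive x y ->
  hd x (y * hd y w) = y * hd (x * y) w.
Proof.
move=> xy; have [vw yv v_max] := head_partP hm y w.
have [v2w xyv2 v2_max] := head_partP hm (x * y) w.
have [hw xh h_max] := head_partP hm x (y * hd y w).
set v := hd y w in vw yv v_max hw xh h_max *.
set v2 := hd (x * y) w in v2w xyv2 v2_max *.
set h := hd x (y * v) in hw xh h_max *.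
have [yv2 xyv2'] := (len_additiveA v2 xy).1 xyv2.
(* In particular [y] is a prefix of [h], which can then be stripped off. *)
have v2h : weak_le (y * v2) h.
  by apply: h_max => //; apply: weak_le_mul2l => //; apply: v_max.
apply: weak_le_anti => //.
have yh : weak_le y h by apply: weak_le_trans v2h; apply/weak_le_mulr.
have hE : h = y * (y^-1 * h) by rewrite mulVKg.
have yh' : len_additive y (y^-1 * h) by [].
rewrite hE; apply: weak_le_mul2l => //; apply: v2_max.
  apply: weak_le_trans vw; have := (weak_le_mul (y^-1 * h) ((weak_le_mulr y v).2 yv)).2.
  by rewrite mulKg -hE; apply.
by apply/(len_additiveA _ xy); split=> //; rewrite -hE.
Qed.

(** Hence the braid relations hold for the operators [greedy_act (s i)], since
    both sides of a braid relation lift one and the same element of [W]. *)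
Lemma greedy_actM (x y : W) p : len_additive x y ->
  greedy_act x (greedy_act y p) = greedy_act (x * y) p.
Proof.
move=> xy; case: p => w n; rewrite /greedy_act /= head_partM // -!mulgA.
have [vw yv v_max] := head_partP hm y w.
have [v2w xyv2 v2_max] := head_partP hm (x * y) w.
set v := hd y w in vw yv v_max *; set v2 := hd (x * y) w in v2w xyv2 v2_max *.
have v2v : weak_le v2 v by apply: v_max => //; case: ((len_additiveA v2 xy).1 xyv2).
congr (_, _); rewrite mulgA; congr (_ * _).
rewrite invgM -mulgA mulKg -lift_mul.
  by rewrite -mulgA mulVKg.
have := (weak_le_mul (v2^-1 * v) v2w).2; rewrite mulVKg => /(_ (conj v2v vw)).
by rewrite {1}/weak_le invgM -[X in len_additive _ X]mulgA mulKg.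
Qed.

Lemma greedy_act1 p : greedy_act 1 p = p.
Proof.
case: p => w n; have [hw _ h_max] := head_partP hm 1 w.
have hE : hd 1 w = w.
  apply: weak_le_anti => //; apply: h_max; first exact: weak_le_refl.
  by rewrite /len_additive mul1g coxlen1.
by rewrite /greedy_act /= hE mul1g mulVg lift1 mul1g.
Qed.

Definition greedy_gen (i : S) (p : W * M) := greedy_act (s i) p.

Lemma greedy_word u p : len (wd u) = size u ->
  foldr greedy_gen p u = greedy_act (wd u) p.
Proof.
elim: u => [|i u IHu]; first by rewrite coxword_nil greedy_act1.
rewrite coxword_cons /= => lu.
have := coxlenM (s i) (wd u); rewrite coxlen_gen lu => h.
have lu' : len (wd u) = size u by have := coxlen_le m u; move: h; len_lia.
by rewrite IHu // /greedy_gen greedy_actM // /len_additive lu lu' coxlen_gen.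
Qed.

Definition normal_form_word (u : seq S) : W * M := foldr greedy_gen (1, 1) u.

Lemma normal_form_congr u v : aw u = aw v -> normal_form_word u = normal_form_word v.
Proof.
move/artin_wordP/word_cong_act; apply=> {u v} _ _ [i [j [-> ->]]] p.
have [-> //|/eqP neq_ij] := eqVneq i j.
rewrite !greedy_word ?size_alternating ?coxlen_alternating // ?coxword_braid //.
- exact/nesym.
- by rewrite cox_sym.
Qed.

Definition normal_form (z : M) : W * M := normal_form_word (prepr z).

Lemma normal_formE u : normal_form (aw u) = normal_form_word u.
Proof. by apply: normal_form_congr; apply: preprK. Qed.

Lemma normal_form_atom i z :
  normal_form (atom m i * z) = greedy_act (s i) (normal_form z).
Proof. by have [u <-] := artin_word_surj z; rewrite -artin_word_cons !normal_formE. Qed.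

(** Pushing a generator multiplies the product of the two components by its atom. *)
Lemma normal_formK z : lift (normal_form z).1 * (normal_form z).2 = z.
Proof.
have [u <-] := artin_word_surj z; elim: u => [|i u IHu].
  by rewrite normal_formE /= lift1 mulg1.
rewrite artin_word_cons normal_form_atom /= -[in RHS]IHu.
case: (normal_form _) => w n /=; have [hw xh _] := head_partP hm (s i) w.
by rewrite lift_mul // lift_gen (lift_weak_le hw) !mulgA.
Qed.

(** From the normal form [(a, n)] of [atom i * x] one recovers [x] as
    [lift (s i ^-1 * a) * n]. *)
Lemma atom_cancel i x y : atom m i * x = atom m i * y -> x = y.
Proof.
have H z : lift ((s i)^-1 * (normal_form (atom m i * z)).1) * (normal_form (atom m i * z)).2 = z.
  rewrite normal_form_atom /= mulKg -[RHS]normal_formK.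
  case: (normal_form z) => w n /=; have [hw _ _] := head_partP hm (s i) w.
  by rewrite (lift_weak_le hw) mulgA.
by move=> xy; rewrite -(H x) -(H y) xy.
Qed.

Lemma artin_mulI (z x y : M) : z * x = z * y -> x = y.
Proof.
have [u <-] := artin_word_surj z; elim: u x y => [|i u IHu] x y.
  by rewrite artin_word_nil !mul1g.
by rewrite artin_word_cons -!mulgA => /atom_cancel/IHu.
Qed.

(** Each atom dividing an element is a prefix of the head of its normal form, so
    that [weak_le_rank2] applies to the head. *)
Lemma artin_lcm i j x y : i <> j -> atom m i * x = atom m j * y ->
  exists z, atom m i * x = aw (alternating (m i j) i j) * z.
Proof.
move=> neq_ij E; pose a := (normal_form (atom m i * x)).1.
have H k z : weak_le (s k) (normal_form (atom m k * z)).1.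
  by rewrite normal_form_atom /=; apply/weak_le_mulr; case: (head_partP hm (s k) (normal_form z).1).
have ia : weak_le (s i) a by apply: H.
have ja : weak_le (s j) a by rewrite /a E; apply: H.
have da := weak_le_rank2 neq_ij ia ja.
rewrite -(normal_formK (atom m i * x)) -/a (lift_weak_le da) lift_alternating // -mulgA.
by eexists.
Qed.

End NormalForm.

(** * The Artin monoid embeds into the Artin group *)

Section Embedding.
Variables (S : choiceType) (m : coxeter_matrix S) (hm : spherical m).

Local Notation W := (coxeter_group m).
Local Notation s := (coxgen m).
Local Notation wd := (coxword m).
Local Notation len := coxlen.
Local Notation M := (artin_monoid m).
Local Notation aw := (artin_word m).
Local Notation w0 := (longest hm).

Lemma coxgen_inj : injective s.
Proof.
move=> i j ij; have [//|/eqP neq_ij] := eqVneq i j.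
have m1 : (0 < 1 < m i j)%N.
  by rewrite /= ltn_neqAle cox_pos andbT eq_sym; apply/eqP => /cox_eq1.
have [] := coxword_alternating_neq1 neq_ij m1.
by rewrite /= coxword_cons coxword_seq1 ij coxgen_sq.
Qed.

Lemma coxlen_eq1 (w : W) : len w = 1%N -> exists i, w = s i.
Proof.
rewrite /coxlen => l1; have := reduced_wordK w.
by case: reduced_word l1 => [|i [|]] // _ <-; exists i.
Qed.

Lemma longest_sq : w0 * w0 = 1.
Proof.
have := weak_le_longest hm w0^-1; rewrite weak_leE coxlenV invgK => E.
by apply: coxlen_eq0; move: E; len_lia.
Qed.

(** Both [w0] and [s i * w0] are below [w0], so [w0] is [s i * w0] followed by an
    element of length 1. *)
Lemma longest_conj i : exists j, s i * w0 = w0 * s j.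
Proof.
have := weak_le_longest hm (s i * w0).
have /weak_le_gen/coxlen_gen_down := weak_le_longest hm (s i).
rewrite weak_leE => -> E.
have [|j jE] := @coxlen_eq1 ((s i * w0)^-1 * w0); first by move: E; len_lia.
by exists j; rewrite -jE invgM coxgenV -mulgA mulVKg.
Qed.

Definition garside : M := lift w0.

Lemma garside_atom_l i : garside = atom m i * lift (s i * w0).
Proof.
by rewrite /garside (lift_weak_le (weak_le_longest hm (s i))) lift_gen coxgenV.
Qed.

Lemma garside_conj i j : s i * w0 = w0 * s j -> atom m i * garside = garside * atom m j.
Proof.
move=> ij; have E := lift_weak_le (weak_le_longest hm (s i * w0)).
have jE : (s i * w0)^-1 * w0 = s j.
  by rewrite invgM coxgenV -mulgA ij mulKg.
rewrite {1}/garside E jE lift_gen mulgA; congr (_ * _).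
by rewrite -garside_atom_l.
Qed.

(** Conjugation by the longest element is an involution of the atoms. *)
Lemma garside_sq_atom i : atom m i * (garside * garside) = garside * garside * atom m i.
Proof.
have [j ij] := longest_conj i; have [k jk] := longest_conj j.
have ki : k = i.
  apply: coxgen_inj; apply: (mulgI w0); rewrite -jk; apply: (mulgI w0).
  by rewrite mulgA -ij -mulgA longest_sq mulg1 mulgA longest_sq mul1g.
by rewrite mulgA (garside_conj ij) -mulgA (garside_conj jk) ki mulgA.
Qed.

Local Notation z := (garside * garside).

Lemma garside_sq_central (x : M) : commute z x.
Proof.
have [u <-] := artin_word_surj x; elim: u => [|i u IHu].
  by rewrite /commute artin_word_nil mul1g mulg1.
rewrite artin_word_cons; apply: commuteM => //.
by rewrite /commute garside_sq_atom.
Qed.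

(** The complement of an atom in the square of the Garside element stands for
    the inverse of the atom, at the cost of one central denominator. *)
Definition atom_compl (i : S) : M := lift (s i * w0) * garside.

Lemma atom_complr i : atom m i * atom_compl i = z.
Proof. by rewrite /atom_compl mulgA -garside_atom_l. Qed.

Lemma atom_compll i : atom_compl i * atom m i = z.
Proof.
apply: (@artin_mulI _ _ hm (atom m i)).
by rewrite mulgA atom_complr garside_sq_central.
Qed.

Definition eval_letter (l : S * bool) : M :=
  if l.2 then atom m l.1 else atom_compl l.1.
Definition numerator (w : seq (S * bool)) : M :=
  foldr (fun l x => eval_letter l * x) 1 w.
Definition denominator (w : seq (S * bool)) : nat := count (fun l => ~~ l.2) w.

Lemma numerator_cat u v : numerator (u ++ v) = numerator u * numerator v.
Proof. by elim: u => [|l u IHu]; rewrite /= ?mul1g // IHu mulgA. Qed.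

Lemma numerator_pos u : numerator (pos_word u) = aw u.
Proof. by elim: u => //= i u ->; rewrite artin_word_cons. Qed.

Lemma denominator_pos (u : seq S) : denominator (pos_word u) = 0%N.
Proof. by rewrite /denominator /pos_word count_map; elim: u. Qed.

Lemma zX_central n (x : M) : x * z ^+ n = z ^+ n * x.
Proof. exact/commuteX/commute_sym/garside_sq_central. Qed.

(** Equality of the fractions [numerator / z ^ denominator]: cross multiplication
    is invariant under the defining relations of the group, transitivity being a
    cancellation of a central factor. *)
Lemma fraction_congr u v : word_cong (group_rel (artin_rel m)) u v ->
  numerator u * z ^+ denominator v = numerator v * z ^+ denominator u.
Proof.
elim=> {u v} [a u v b Ruv|//|? ? _ ->//|u v w _ h1 _ h2].
  rewrite /denominator !numerator_cat !count_cat -/denominator.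
  rewrite -/(denominator u) -/(denominator v) -/(denominator a) -/(denominator b).
  have uv : numerator u * z ^+ denominator v = numerator v * z ^+ denominator u.
    case: Ruv => [[x [y [xy -> ->]]]|[[i e] [-> ->]]].
      rewrite !denominator_pos !numerator_pos.
      by congr (_ * _); apply/artin_wordP/word_cong_rel.
    rewrite /= mulg1 mul1g; case: e; rewrite /eval_letter /= mulg1.
      by rewrite atom_complr.
    by rewrite atom_compll.
  have shift k (x y t : M) : x * (y * (z ^+ k * t)) = x * z ^+ k * (y * t).
    by rewrite [y * _]mulgA (zX_central k y) -!mulgA.
  rewrite (addnCA _ (denominator v)) (addnCA _ (denominator u)) ![z ^+ (_ + _)]expgnDr -!mulgA.
  by congr (_ * _); rewrite !shift uv.
have shift k l (x : M) : x * z ^+ k * z ^+ l = x * z ^+ l * z ^+ k.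
  by rewrite -!mulgA zX_central.
apply: (@artin_mulI _ _ hm (z ^+ denominator v)); rewrite -!zX_central.
by rewrite shift h1 shift h2 shift.
Qed.

Lemma artin_canon_inj : injective (@artin_canon S m).
Proof.
move=> x y; have [u <-] := artin_word_surj x; have [v <-] := artin_word_surj y.
rewrite /artin_canon /artin_word !monoid_to_groupE => /pwordP/fraction_congr.
by rewrite !denominator_pos !numerator_pos !mulg1.
Qed.

End Embedding.

(** * Order automorphisms of the Artin group *)

Section ShortAlternatingWords.
Variables (S : choiceType) (m : coxeter_matrix S).

Lemma alternating_adjacent k (a b i j : S) u v :
  alternating k a b = u ++ i :: j :: v -> (i = a /\ j = b) \/ (i = b /\ j = a).
Proof.
elim: k a b u => [|k IHk] a b [|x u] //=.
  by case: k {IHk} => //= k [<- <- _]; left.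
by case=> _ /IHk []; [right|left].
Qed.

(** No braid relation applies to an alternating word of length less than
    [m a b], as its factors of length 2 only involve [a] and [b]. *)
Lemma alternating_rigid k a b v : (k < m a b)%N ->
  artin_word m v = artin_word m (alternating k a b) -> v = alternating k a b.
Proof.
move=> km /artin_wordP vk; set w := alternating k a b in vk *.
suff H x y : word_cong (artin_rel m) x y -> (x = w <-> y = w) by apply/(H _ _ vk).
have step c d i j : c ++ alternating (m i j) i j ++ d = w ->
    c ++ alternating (m i j) j i ++ d = w.
  have [-> //|/eqP neq_ij] := eqVneq i j.
  move=> E; have mk : (m i j <= k)%N.
    rewrite -(size_alternating k a b) -/w -E !size_cat size_alternating.
    by rewrite addnCA leq_addr.
  have m1 : (1 < m i j)%N.
    by rewrite ltn_neqAle cox_pos andbT eq_sym; apply/eqP => /cox_eq1.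
  move: m1 E; case E : (m i j) => [|[|l]] // _ /esym/alternating_adjacent ab.
  by move: km mk; case: ab => -[<- <-]; rewrite 1?(cox_sym m j i) ltnNge => /negP.
elim=> {x y} [c x y d [i [j [-> ->]]]|//|? ? _ h|? ? ? _ h1 _ h2].
- split; first exact: step.
  by have := step c d j i; rewrite (cox_sym m j i).
- by split=> /h.
- by split=> [/h1/h2|/h2/h1].
Qed.

End ShortAlternatingWords.

Section ArtinOrder.
Variables (S : choiceType) (m : coxeter_matrix S) (hm : spherical m).

Local Notation G := (artin_group m).
Local Notation M := (artin_monoid m).
Local Notation sg := (sigma m).
Local Notation aw := (artin_word m).
Local Notation canon := (@artin_canon S m).

Lemma artin_canonM x y : canon (x * y) = canon x * canon y.
Proof. exact: monoid_to_groupM. Qed.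

Lemma artin_canon_atom i : canon (atom m i) = sg i.
Proof. exact: monoid_to_groupE. Qed.

Lemma artin_leP (g h : G) : reflect (exists x : M, h = g * canon x) (g <= h).
Proof.
apply: (iffP (asboolP _)) => -[x E]; exists x; first by rewrite -E mulVKg.
by rewrite E mulKg.
Qed.

Lemma artin_le_canon (g : G) x : g <= g * canon x.
Proof. by apply/artin_leP; exists x. Qed.

Lemma atom_neq1 i x y : x * atom m i * y <> 1 :> M.
Proof.
have [u <-] := artin_word_surj x; have [v <-] := artin_word_surj y.
rewrite -[atom m i]/(aw [:: i]) -!artin_word_cat => /(@artin_word_size _ _ _ [::]).
by rewrite !size_cat addn1.
Qed.

Lemma sigma_inj : injective sg.
Proof.
move=> i j; rewrite -!artin_canon_atom => /(artin_canon_inj hm) ij.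
have [//|/eqP neq_ij] := eqVneq i j.
have m1 : (1 < m j i)%N.
  by rewrite ltn_neqAle cox_pos andbT eq_sym; apply/eqP => /cox_eq1 /esym.
by have [] := alternating_rigid m1 ij.
Qed.

Lemma mul_sigma_neq (g : G) i : g * sg i <> g.
Proof.
rewrite -[RHS]mulg1 => /mulgI; rewrite -artin_canon_atom -artin_canon1.
move/(artin_canon_inj hm) => E.
by apply: (@atom_neq1 i 1 1); rewrite mul1g mulg1.
Qed.

Lemma le_mul_sigma (g : G) i : g <= g * sg i.
Proof. by rewrite -artin_canon_atom artin_le_canon. Qed.

Lemma artin_lt_sigma (g h : G) : g <= h -> g <> h -> exists i, g * sg i <= h.
Proof.
move=> /artin_leP[x ->]; have [[|i u] <-] := artin_word_surj x.
  by rewrite artin_word_nil artin_canon1 mulg1.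
move=> _; exists i; rewrite artin_word_cons artin_canonM mulgA artin_canon_atom.
exact: artin_le_canon.
Qed.

(** Lengths of positive words are well defined, and [sigma_i] has length 1. *)
Lemma sigma_cover (g h : G) i : g <= h -> h <= g * sg i -> h = g \/ h = g * sg i.
Proof.
move=> /artin_leP[x ->] /artin_leP[y].
rewrite -mulgA => /mulgI; rewrite -artin_canonM -artin_canon_atom.
move=> /(artin_canon_inj hm); have [u <-] := artin_word_surj x.
have [v <-] := artin_word_surj y; rewrite -artin_word_cat => E.
have := artin_word_size (E : aw [:: i] = _); rewrite size_cat.
case: u E => [|j u] E; first by left; rewrite artin_canon1 mulg1.
case: u v E => [|? ?] [|? ?] // E _; right.
by rewrite E cats0.
Qed.

Lemma artin_group_ind (P : G -> Prop) :
  P 1 -> (forall g i, P g -> P (g * sg i)) -> (forall g i, P g -> P (g * (sg i)^-1)) ->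
  forall g, P g.
Proof.
move=> P1 PM PV g; rewrite -(greprK g); elim/last_ind: (grepr g) => [//|w [i b] Pw].
have -> : gword (artin_rel m) (rcons w (i, b)) =
    gword (artin_rel m) w * gword (artin_rel m) [:: (i, b)] by rewrite gwordM cats1.
case: b; first exact: PM.
have -> : gword (artin_rel m) [:: (i, false)] = (sg i)^-1; last exact: PV.
exact/esym/mulg1_eq/(gword_mulV _ [:: (i, true)]).
Qed.

Definition dihedral_lcm i j : G := canon (aw (alternating (m i j) i j)).

Lemma le_dihedral_lcm (g : G) i j : g * sg i <= g * dihedral_lcm i j.
Proof.
rewrite /dihedral_lcm; have := cox_pos m i j; case: (m i j) => // k _.
rewrite alternatingS artin_word_cons artin_canonM mulgA artin_canon_atom.
exact: artin_le_canon.
Qed.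

Lemma dihedral_lcmC i j : dihedral_lcm i j = dihedral_lcm j i.
Proof. by rewrite /dihedral_lcm artin_word_braid cox_sym. Qed.

Lemma dihedral_lcm_le (g h : G) i j : i <> j ->
  g * sg i <= h -> g * sg j <= h -> g * dihedral_lcm i j <= h.
Proof.
move=> neq_ij /artin_leP[x xE] /artin_leP[y].
rewrite xE -!mulgA -!artin_canon_atom => /mulgI.
rewrite -!artin_canonM => /(artin_canon_inj hm)/(artin_lcm hm neq_ij)[z ->].
by rewrite artin_canonM mulgA artin_le_canon.
Qed.

Lemma le2_dihedral_lcm (g : G) i j : i <> j -> g * sg i * sg j <= g * dihedral_lcm i j.
Proof.
move=> neq_ij; have m1 : (1 < m i j)%N.
  by rewrite ltn_neqAle cox_pos andbT eq_sym; apply/eqP => /cox_eq1.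
move: m1; rewrite /dihedral_lcm; case E : (m i j) => [|[|l]] // _.
rewrite !alternatingS !artin_word_cons !artin_canonM !mulgA !artin_canon_atom.
exact: artin_le_canon.
Qed.

(** After cancelling [sigma_i], an alternating word of length [m i j - 1]
    remains, which is alone in its class. *)
Lemma sigma2_le_dihedral_lcm (g : G) i j k : i <> j ->
  g * sg i * sg k <= g * dihedral_lcm i j -> k = j.
Proof.
move=> neq_ij /artin_leP[x]; rewrite -!mulgA => /mulgI.
rewrite -!artin_canon_atom -!artin_canonM => /(artin_canon_inj hm).
have m1 : (1 < m i j)%N.
  by rewrite ltn_neqAle cox_pos andbT eq_sym; apply/eqP => /cox_eq1.
move: m1; case E : (m i j) => [|[|l]] // _.
rewrite alternatingS artin_word_cons => /(atom_cancel hm).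
have [u <-] := artin_word_surj x; rewrite -artin_word_cons => /esym.
have lm : (l.+1 < m j i)%N by rewrite cox_sym E.
by move/(alternating_rigid lm); rewrite alternatingS => -[].
Qed.

(** Order automorphisms preserve the covering relation. *)
Lemma order_aut_sigma_ex (f f' : G -> G) (fK : cancel f f') (fK' : cancel f' f)
    (f_mono : {mono f : g h / g <= h}) g i :
  exists j, f (g * sg i) = f g * sg j.
Proof.
have [||j jP] := @artin_lt_sigma (f g) (f (g * sg i)).
- by rewrite f_mono le_mul_sigma.
- by move/(can_inj fK)/esym/mul_sigma_neq.
exists j; rewrite -(fK' (f g * sg j)).
have [||E|->//] := @sigma_cover g (f' (f g * sg j)) i.
- by rewrite -f_mono fK' le_mul_sigma.
- by rewrite -f_mono fK'.
by have := @mul_sigma_neq (f g) j; rewrite -{2}E fK'.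
Qed.

(** Only covers, joins of pairs of covers and lengths of chains enter the proof. *)
Lemma order_aut_diagram (f f' : G -> G) (fK : cancel f f') (fK' : cancel f' f) :
  {mono f : g h / g <= h} -> f 1 = 1 -> diagram_automorphisms m f.
Proof.
move=> f_mono f1.
have f'_mono : {mono f' : g h / g <= h} by move=> g h; rewrite -f_mono !fK'.
have [phi phiP] : exists phi : G -> S -> S, forall g i, f (g * sg i) = f g * sg (phi g i).
  have [phi phiP] := choice (fun p : G * S => order_aut_sigma_ex fK fK' f_mono p.1 p.2).
  by exists (fun g i => phi (g, i)) => g i; rewrite (phiP (g, i)).
have phi_inj g : injective (phi g).
  move=> i j ij; apply: sigma_inj; apply: (mulgI g); apply: (can_inj fK).
  by rewrite !phiP ij.
have phi_surj g j : exists i, phi g i = j.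
  have [i iP] := order_aut_sigma_ex fK' fK f'_mono (f g) j.
  exists i; apply: sigma_inj; apply: (mulgI (f g)).
  by rewrite -phiP -[X in f (X * _)]fK -iP fK'.
have lcmP g i j : i <> j ->
    f (g * dihedral_lcm i j) = f g * dihedral_lcm (phi g i) (phi g j).
  move=> neq_ij; have neq_phi : phi g i <> phi g j by move/phi_inj.
  apply/eqP; rewrite eq_le; apply/andP; split.
    rewrite -[leRHS]fK' f_mono; apply: dihedral_lcm_le => //.
      by rewrite -f_mono fK' phiP le_dihedral_lcm.
    by rewrite -f_mono fK' phiP dihedral_lcmC le_dihedral_lcm.
  apply: dihedral_lcm_le => //; rewrite -phiP f_mono ?le_dihedral_lcm //.
  by rewrite dihedral_lcmC le_dihedral_lcm.
have sizeP g u : exists v, size v = size u /\ f (g * canon (aw u)) = f g * canon (aw v).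
  elim: u g => [|i u IHu] g.
    by exists [::]; rewrite artin_word_nil artin_canon1 !mulg1.
  have [v [vu vE]] := IHu (g * sg i); exists (phi g i :: v); rewrite /= vu; split=> //.
  by rewrite !artin_word_cons !artin_canonM !mulgA !artin_canon_atom vE phiP.
have mP g i j : m (phi g i) (phi g j) = m i j.
  have [->|/eqP neq_ij] := eqVneq i j.
    by rewrite (cox_eq1 m _ _).2 // (cox_eq1 m _ _).2.
  have [v [vE]] := sizeP g (alternating (m i j) i j).
  rewrite -/(dihedral_lcm i j) lcmP // => /mulgI/(artin_canon_inj hm)/artin_word_size.
  by rewrite vE !size_alternating.
(* The element [g * sigma_i * sigma_k] lies below [g * D_ik]. *)
have phi_step g i j : phi (g * sg i) j = phi g j.
  have off k : k <> i -> phi (g * sg i) k = phi g k.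
    move=> ki; apply: (@sigma2_le_dihedral_lcm (f g) (phi g i)).
      by move/phi_inj/esym.
    rewrite -lcmP; last exact/nesym.
    by rewrite -!phiP f_mono; apply/le2_dihedral_lcm/nesym.
  have [->|/eqP] := eqVneq j i; last exact: off.
  (* The value at [i] is the only one left for a bijection. *)
  have [k kE] := phi_surj g (phi (g * sg i) i).
  have [ki|/eqP ki] := eqVneq k i; first by rewrite -kE ki.
  by case: (ki); apply: (phi_inj (g * sg i)); rewrite off.
have phi_const g i : phi g i = phi 1 i.
  elim/artin_group_ind: g => [//|g j <-|g j <-]; first exact: phi_step.
  by rewrite -(phi_step _ j) mulgVK.
have fV g i : f (g * (sg i)^-1) = f g * (sg (phi 1 i))^-1.
  by rewrite -(phi_const (g * (sg i)^-1)) -[X in f X * _](mulgVK (sg i)) phiP mulgK.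
have fM : {morph f : g h / g * h}.
  move=> g h; elim/artin_group_ind: h => [|h i IHh|h i IHh].
  - by rewrite f1 !mulg1.
  - by rewrite mulgA !phiP IHh !phi_const mulgA.
  - by rewrite mulgA !fV IHh mulgA.
have [psi psiP] := choice (phi_surj 1).
exists (phi 1); split=> //.
- by exists psi => // i; apply: (phi_inj 1); rewrite psiP.
- by exists f'.
- by move=> i; rewrite -[sg i]mul1g phiP f1 !mul1g.
Qed.

End ArtinOrder.

(** * Formations and skew braces *)

Section FormationBrace.
Variables (S : choiceType) (m : coxeter_matrix S) (hm : spherical m).

Local Notation G := (artin_group m).
Implicit Types F : formation G.

Definition transported_law F (g h : G) : G := form_iso F (form_inv F g * form_inv F h).

Lemma form_inv1 F : form_inv F 1 = 1.
Proof. by rewrite -(form_iso1 F) form_isoK. Qed.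

Lemma transported_law_group F : is_group_law (transported_law F).
Proof.
split=> [g h k|]; first by rewrite /transported_law !form_isoK mulgA.
exists 1; split=> [g|g|].
- by rewrite /transported_law form_inv1 mul1g form_invK.
- by rewrite /transported_law form_inv1 mulg1 form_invK.
exists (fun g => form_iso F (form_inv F g)^-1).
by split=> g; rewrite /transported_law form_isoK ?mulVg ?mulgV form_iso1.
Qed.

Lemma leftOrdered_mul2l (H : leftOrderedGroupType) (x : H) : {mono *%g x : y z / y <= z}.
Proof.
move=> y z; apply/idP/idP; last exact: lo_mul2l.
by move=> /(lo_mul2l x^-1); rewrite !mulKg.
Qed.

(** The two left translations, in [H] and in the Artin group, are order
    automorphisms, and their combination fixes [1]. *)
Lemma transported_lambda_diagram F (g : G) :
  diagram_automorphisms m (fun h => g^-1 * transported_law F g h).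
Proof.
pose f h := g^-1 * transported_law F g h.
pose f' h := form_iso F ((form_inv F g)^-1 * form_inv F (g * h)).
apply: (@order_aut_diagram _ _ hm f f').
- by move=> h; rewrite /f /f' mulVKg /transported_law form_isoK mulKg form_invK.
- by move=> h; rewrite /f /f' /transported_law form_isoK mulVKg form_invK mulKg.
- move=> h k; rewrite /f leftOrdered_mul2l /transported_law form_mono.
  by rewrite leftOrdered_mul2l -(form_mono F) !form_invK.
- by rewrite /f /transported_law form_inv1 mulg1 form_invK mulVg.
Qed.

(** Multiplicativity of [lambda_a]. *)
Lemma transported_law_distr F (a b c : G) :
  transported_law F a (b * c) = transported_law F a b * a^-1 * transported_law F a c.
Proof.
have [_ [_ _ fM _ _]] := transported_lambda_diagram F a.
apply: (mulgI a^-1); rewrite -!mulgA; have /= := fM b c; rewrite -!mulgA => ->.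
by [].
Qed.

Definition transported_brace F : skew_brace G :=
  SkewBrace (transported_law_group F) (transported_law_distr F).

Lemma transported_brace_diagram F :
  range (lambda (transported_brace F)) `<=` diagram_automorphisms m.
Proof. by move=> _ [g _ <-]; apply: transported_lambda_diagram. Qed.

Definition formation_brace F : diagram_brace m :=
  exist _ (transported_brace F) (@transported_brace_diagram F).

Lemma diagram_brace_eq (B B' : diagram_brace m) :
  (forall g h, circ (sval B) g h = circ (sval B') g h) -> B = B'.
Proof.
case: B B' => [[c gl cd] p] [[c' gl' cd'] p'] /= E.
have {}E : c = c' by apply/funext => g; apply/funext.
subst c'; rewrite (Prop_irrelevance gl' gl) (Prop_irrelevance cd' cd) in p' *.
by rewrite (Prop_irrelevance p' p).
Qed.

Lemma formation_equiv_refl F : formation_equiv F F.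
Proof. by exists id; split=> //; exists id. Qed.

Lemma formation_equiv_sym F F' : formation_equiv F F' -> formation_equiv F' F.
Proof.
case=> f [[f' fK fK'] fM f_mono f_iso]; exists f'; split.
- by exists f.
- by move=> x y; apply: (can_inj fK); rewrite fM !fK'.
- by move=> x y; rewrite -f_mono !fK'.
- by move=> x; rewrite -f_iso fK'.
Qed.

Lemma formation_equiv_trans F F' F'' :
  formation_equiv F F' -> formation_equiv F' F'' -> formation_equiv F F''.
Proof.
case=> f [f_bij fM f_mono f_iso] [g [g_bij gM g_mono g_iso]]; exists (g \o f); split.
- exact: bij_comp.
- by move=> x y /=; rewrite fM gM.
- by move=> x y /=; rewrite g_mono f_mono.
- by move=> x /=; rewrite g_iso f_iso.
Qed.

Lemma class_of_eq F F' : formation_equiv F F' -> class_of F = class_of F'.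
Proof.
move=> FF'; apply: eq_exist; apply/funext => E; apply/propext; split.
  exact/formation_equiv_trans/formation_equiv_sym.
exact: formation_equiv_trans.
Qed.

Lemma formation_equiv_circ F F' : formation_equiv F F' ->
  forall g h, transported_law F g h = transported_law F' g h.
Proof.
case=> f [_ fM _ f_iso] g h; rewrite /transported_law -f_iso fM.
have fE k : f (form_inv F k) = form_inv F' k.
  by apply: (can_inj (form_isoK F')); rewrite f_iso !form_invK.
by rewrite !fE.
Qed.

(** The order isomorphism of the formation is an isomorphism onto the transported
    group by definition of the transported law. *)
Lemma brace_formation_equiv F : formation_equiv F (brace_formation (formation_brace F)).
Proof.
exists (form_iso F); split=> //.
- by exists (form_inv F); [apply: form_isoK|apply: form_invK].
- by move=> x y; rewrite -{1}(form_isoK F x) -{1}(form_isoK F y).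
- exact: form_mono.
Qed.

End FormationBrace.

Theorem theorem3p3 (S : choiceType) (m : coxeter_matrix S) (hm : spherical m) :
  exists to_brace : formation_class (artin_group m) -> diagram_brace m,
    [/\ forall (F : formation (artin_group m)) (g h : artin_group m),
          circ (sval (to_brace (class_of F))) g h
            = form_iso F (form_inv F g * form_inv F h),
        cancel to_brace (fun B => class_of (brace_formation B))
      & cancel (fun B => class_of (brace_formation B)) to_brace].
Proof.
have repr (C : formation_class (artin_group m)) : exists F, C = class_of F.
  by case: C => C [F CF]; exists F; apply: eq_exist.
have [rep repP] := choice repr.
have rep_equiv F : formation_equiv (rep (class_of F)) F.
  have /(congr1 sval)/= <- := repP (class_of F).
  exact: formation_equiv_refl.
have circE F g h : circ (sval (formation_brace hm (rep (class_of F)))) g h =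
    form_iso F (form_inv F g * form_inv F h).
  exact: formation_equiv_circ (rep_equiv F) g h.
exists (fun C => formation_brace hm (rep C)); split=> //.
- move=> C; rewrite [RHS]repP; apply/esym/class_of_eq.
  exact: brace_formation_equiv.
- by move=> B; apply: diagram_brace_eq => g h; rewrite circE.
Qed.
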